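(* Let $\{c_k\}_{k=1}^{\infty}$ be a nonnegative nonincreasing sequence of real numbers. Then: (a) if $\alpha$ is an even natural number, then the series $\sum_{k=1}^{\infty}c_k\sin (k^{\alpha} x)$ converges at the point $x=\frac{\pi}{2}$ or at the point $x=\frac{2\pi}{3}$ only if $\sum_{k=1}^{\infty}c_k<\infty$ (that is, convergence at either one of these two points implies $\sum_{k=1}^\infty c_k<\infty$); (b) if $\alpha$ is an odd natural number and $f$ is a polynomial of degree $\alpha$ with rational coefficients containing only odd powers of the variable, then for uniform convergence of the series $\sum_{k=1}^{\infty}c_k\sin (f(k) x)$ in $x\in\mathbb{R}$ it is sufficient that $c_kk\to 0$ as $k\to\infty$; (c) if $\alpha\in (0,2)$ is real, then for uniform convergence of the series $\sum_{k=1}^{\infty}c_k\sin (k^{\alpha} x)$ on any bounded subset of $\mathbb{R}$ it is sufficient that $c_kk\to 0$ as $k\to\infty$.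
   Context: Natural numbers are the positive integers. A polynomial $f$ of odd degree $\alpha$ with rational coefficients in odd powers is one of the form $f(k)=\sum_{1\le j\le \alpha,\ j\text{ odd}} q_j k^j$ with $q_j\in\mathbb{Q}$ and $q_\alpha\ne 0$. Convergence of a series means convergence of its partial sums $\sum_{k=1}^{L}$ as $L\to\infty$; uniform convergence on a set means uniform convergence of these partial sums in $x$ on that set. *)

(* Defs.v *)
From mathcomp Require Export all_boot all_order all_algebra.
From mathcomp Require Export all_classical all_reals all_analysis.
Export Order.TTheory GRing.Theory Num.Theory.
Export numFieldNormedType.Exports.
Set Implicit Arguments.
Unset Strict Implicit.
Unset Printing Implicit Defensive.
Local Open Scope classical_set_scope.
Local Open Scope ring_scope.

(* Series are indexed by k >= 1: the value of a sequence at 0 is never used. *)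
Definition series1 (R : realType) (u : nat -> R) (L : nat) : R :=
  \sum_(1 <= k < L.+1) u k.

Definition sine_sum (R : realType) (c phi : nat -> R) (L : nat) (x : R) : R :=
  series1 (fun k => c k * sin (phi k * x)) L.

Definition uniformly_convergent_on (R : realType) (A : set R)
    (F : nat -> R -> R) : Prop :=
  exists g : R -> R, {uniform A, F @ \oo --> g}.

(* Unlike [odd_poly], this does not reindex: f itself has no monomial of even
   degree (in particular no constant term). *)
Definition odd_powers_only (f : {poly rat}) : Prop :=
  forall j : nat, ~~ odd j -> f`_j = 0.

(* Main.v *)
(** (a) At the two points the sine is a positive constant on the k not divisible
    by 2 (resp. 3) and zero elsewhere, and monotonicity of c controls the
    skipped terms.

    (b), (c) By Abel summation it is enough to bound, uniformly in x, the sum over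
    the geometric blocks [N, rN) of |sum of sines over an initial part of the
    block| / N.

    For k^alpha with alpha <> 1, second differences of the phase have size
    |x| N^(alpha-2), and van der Corput's test gives O(1/s + s/N) with
    s^2 = |x| N^alpha; the trivial bound O(s^2) takes over for s < 1.

    For an odd integer polynomial F of degree d >= 3 and x = 2 pi t, Weyl
    differencing shows that either the block sum saves a power of N, or t is within
    N^(-d+eps) of a fraction a/q with q <= N^eps.  In the latter case the block sum
    is, up to a power saving, G(a,q)/q times the sum of sin (2 pi (t - a/q) F(k)),
    with no cosine term since F is odd.  With y = |t - a/q| N^d this smooth sum is
    O(N min(y, 1/y)), so its contributions over all N sharing the same a/q stay
    bounded; moreover |G(a,q)| <= q^(1-eps), and distinct fractions occurring at
    different scales have rapidly growing denominators, so everything is summable. *)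

Require Import Defs.
From mathcomp Require Import ring lra zify.
Local Open Scope classical_set_scope.
Local Open Scope ring_scope.
Set Implicit Arguments.
Unset Strict Implicit.
Unset Printing Implicit Defensive.

(** * Even powers *)

(** The hypothesis on [c k * k] makes the weight of each block small but gives no decay from one
    block to the next. So bounding each normalised block sum is not enough: their total over all
    scales must be bounded uniformly in [x], and near a fraction a cosine term would contribute
    about the same amount at every scale with small [y]. All sums are kept real. Weyl's inequality
    is put in inverse form because its induction on the degree may then lose any power of the saving
    [T]: in place of divisor bounds there is a pigeonhole over the shifts and a recurrence lemma for
    dense sets. The result is used twice, on a block to find the fraction and on one full period to
    bound the complete sum. At scale [i] the block starts at [T ^ (3 * A + 2)] with [T = 2 ^ i], so
    a saving of one factor [T] is already a geometric series in [i]. Fractions are sorted by the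
    logarithm [e] of the denominator to base [2 ^ A.+1]: two fractions in one class must coincide,
    and class [e] carries a factor [2 ^ -e] from its complete sum. *)

Section EvenPowers.
Context {R : realType}.
Implicit Types (x : R) (c : nat -> R).

Lemma sin_natpi2 n x : sin (x + n%:R * (2 * pi)) = sin x.
Proof.
rewrite -(periodicn (@sinD2pi R) n x); congr (sin (x + _)).
by rewrite -[pi *+ 2]mulr_natl -[RHS]mulr_natl.
Qed.

Lemma sin_intpi2 (n : int) x : sin (x + n%:~R * (2 * pi)) = sin x.
Proof.
case: (intP n) => [|k|k]; rewrite ?mul0r ?addr0 //; first exact: sin_natpi2.
by rewrite -[in RHS](subrK (k.+1%:R * (2 * pi)) x) sin_natpi2 mulrNz mulNr.
Qed.

Lemma cos_intpi2 (n : int) x : cos (x + n%:~R * (2 * pi)) = cos x.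
Proof. by rewrite -!sinDpihalf -addrAC sin_intpi2. Qed.

Lemma expn_even_mod m k alpha : ~~ odd alpha ->
  (k ^ 2 = 1 %[mod m])%N -> (k ^ alpha = 1 %[mod m])%N.
Proof.
move=> ev h; have -> : alpha = (2 * alpha./2)%N.
  by rewrite mul2n -[LHS]odd_double_half (negbTE ev).
by rewrite expnM -modnXm h modnXm exp1n.
Qed.

(** Modulo 4 an even positive power is 1 at odd [k] and 0 at even [k], and [sin (m * pi / 2)]
    depends only on [m] modulo 4. *)
Lemma sin_pihalf_pow alpha k : ~~ odd alpha -> (0 < alpha)%N ->
  sin (k%:R ^+ alpha * (pi / 2)) = (odd k)%:R :> R.
Proof.
move=> ev a0; rewrite -natrX; case: (boolP (odd k)) => ok /=.
  (* Adding the multiple of 4 back on both sides of the congruence turns it, by [divn_eq], into a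
     formula for [k ^ alpha] itself. *)
  have /(congr1 (fun m => (k ^ alpha) %/ 4 * 4 + m)%N) : (k ^ alpha = 1 %[mod 4])%N.
    apply: expn_even_mod => //.
    have -> : (k ^ 2 = (k./2 * k./2 + k./2) * 4 + 1)%N.
      have {1}-> : (k = 1 + k./2 * 2)%N by rewrite muln2 -{1}(odd_double_half k) ok.
      by rewrite expnS expn1; ring.
    by rewrite modnMDl.
  rewrite -divn_eq [(1 %% _)%N]modn_small // => ->; rewrite natrD natrM -[RHS]sin_pihalf.
  by rewrite -(sin_natpi2 ((k ^ alpha) %/ 4) (pi / 2)); congr sin; field.
have : (4 %| k ^ alpha)%N.
  apply: (@dvdn_trans (2 ^ alpha)); last by rewrite dvdn_exp2r // dvdn2.
  by rewrite (@dvdn_exp2l 2 2) //; case: alpha ev a0 => [|[|]].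
move=> /dvdnP[m ->]; rewrite natrM -[RHS]sin0 -(sin_natpi2 m 0).
by congr sin; field.
Qed.

Lemma sin_2pithird_gt0 : 0 < sin (2 * pi / 3) :> R.
Proof. by apply: sin_gt0_pi; have := pi_gt0 R; lra. Qed.

Lemma sin_2pithird_pow alpha k : ~~ odd alpha -> (0 < alpha)%N ->
  sin (k%:R ^+ alpha * (2 * pi / 3)) = (~~ (3 %| k))%N%:R * sin (2 * pi / 3) :> R.
Proof.
move=> ev a0; rewrite -natrX; case: (boolP (3 %| k)%N) => ok /=.
  have /dvdnP[m ->] : (3 %| k ^ alpha)%N by apply: dvdn_exp.
  rewrite natrM mul0r -[RHS]sin0 -(sin_natpi2 m 0).
  by congr sin; field.
have /(congr1 (fun m => (k ^ alpha) %/ 3 * 3 + m)%N) : (k ^ alpha = 1 %[mod 3])%N.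
  apply: expn_even_mod => //; rewrite -modnXm; move: ok; rewrite /dvdn.
  by have := ltn_pmod k (isT : 0 < 3)%N; case: (k %% 3)%N => [|[|[|]]].
rewrite -divn_eq [(1 %% _)%N]modn_small // => ->; rewrite natrD natrM mul1r.
by rewrite -[RHS](sin_natpi2 ((k ^ alpha) %/ 3)); congr sin; field.
Qed.

(** A skipped index follows a kept one, whose term is at least as large, so each kept term is
    charged at most twice. *)
Lemma sum_le_double_thinned c (chi : nat -> bool) L :
  (forall k, (0 < k)%N -> 0 <= c k) -> (forall k, (0 < k)%N -> c k.+1 <= c k) ->
  chi 1%N -> (forall k, chi k || chi k.+1) ->
  series1 c L <= 2 * series1 (fun k => c k * (chi k)%:R) L.
Proof.
move=> c0 cd chi1 chiS; rewrite /series1.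
suff : forall n, \sum_(1 <= k < n.+2) c k + (chi n.+1)%:R * c n.+1 <=
    2 * \sum_(1 <= k < n.+2) (c k * (chi k)%:R).
  case: L => [|L] h; first by rewrite !big_geq // mulr0.
  by apply: le_trans (h L); rewrite lerDl mulr_ge0 // ?c0.
elim=> [|n IH]; first by rewrite !big_nat1 chi1 /=; lra.
rewrite big_nat_recr //= [in leRHS]big_nat_recr //= mulrDr.
have := chiS n.+1; have := cd n.+1 isT; move: IH.
case: (chi n.+1); case: (chi n.+2) => //=; have := c0 n.+2 isT; lra.
Qed.

Lemma cvg_series1_of_thinned c (chi : nat -> bool) (s : R) :
  (forall k, (0 < k)%N -> 0 <= c k) -> (forall k, (0 < k)%N -> c k.+1 <= c k) ->
  chi 1%N -> (forall k, chi k || chi k.+1) -> 0 < s ->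
  cvgn (series1 (fun k => c k * ((chi k)%:R * s))) -> cvgn (series1 c).
Proof.
move=> c0 cd chi1 chiS s0 cv.
have [M [_ hM]] := cvg_seq_bounded cv.
have {}hM : forall L, series1 (fun k => c k * ((chi k)%:R * s)) L <= M + 1.
  move=> L; apply: le_trans (ler_norm _) _.
  by have /= := hM (M + 1) _ L I; apply; rewrite ltrDl.
apply: nondecreasing_is_cvgn.
  apply/nondecreasing_seqP => n; rewrite /series1 [leRHS]big_nat_recr //= lerDl.
  exact: c0.
exists (2 * ((M + 1) / s)) => _ [L _ <-].
apply: (le_trans (@sum_le_double_thinned c chi L c0 cd chi1 chiS)).
rewrite ler_pM2l // ler_pdivlMr //; apply: le_trans (hM L).
rewrite /series1 mulr_suml; apply: ler_sum => k _; by rewrite mulrA.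
Qed.

Lemma cvg_even_power_sine c alpha :
  (forall k, (0 < k)%N -> 0 <= c k) -> (forall k, (0 < k)%N -> c k.+1 <= c k) ->
  (0 < alpha)%N -> ~~ odd alpha ->
  cvgn (fun L : nat => sine_sum c (fun k => k%:R ^+ alpha) L (pi / 2))
  \/ cvgn (fun L : nat => sine_sum c (fun k => k%:R ^+ alpha) L (2 * pi / 3)) ->
  cvgn (series1 c).
Proof.
move=> c0 cd a0 ev [] cv.
- apply: (@cvg_series1_of_thinned c odd 1) => //; first by move=> k /=; case: odd.
  rewrite (_ : series1 _ = fun L => sine_sum c (fun k => k%:R ^+ alpha) L (pi / 2)) //.
  apply/funext => L; rewrite /sine_sum /series1; apply: eq_bigr => k _.
  by rewrite sin_pihalf_pow // mulr1.
- apply: (@cvg_series1_of_thinned c (fun k => ~~ (3 %| k)%N) (sin (2 * pi / 3))) => //.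
  + by move=> k; rewrite -negb_and; apply/negP => /andP[]; lia.
  + exact: sin_2pithird_gt0.
  rewrite (_ : series1 _ = fun L => sine_sum c (fun k => k%:R ^+ alpha) L (2 * pi / 3)) //.
  apply/funext => L; rewrite /sine_sum /series1; apply: eq_bigr => k _.
  by rewrite sin_2pithird_pow.
Qed.

End EvenPowers.

(** * The block criterion *)

Section BlockCriterion.
Context {R : realType}.

(* Comparable to min(y, 1/y), and dominated by a difference of y / (1 + y) along a
   geometric progression: hence sums over all scales are bounded uniformly in y. *)
Definition hump (y : R) := y / (1 + y) ^+ 2.

Lemma hump_ge0 y : 0 <= y -> 0 <= hump y.
Proof. by move=> y0; rewrite divr_ge0 // sqr_ge0. Qed.

(** The right side collapses to [r * y / ((1 + r * y) * (1 + y))], and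
    [1 + r * y <= r * (1 + y)]. *)
Lemma hump_le_diff (r y : R) : 1 < r -> 0 <= y ->
  hump y <= r / (r - 1) * (r * y / (1 + r * y) - y / (1 + y)).
Proof.
move=> r1 y0; have ry0 : 0 <= r * y by rewrite mulr_ge0 //; lra.
have -> : r / (r - 1) * (r * y / (1 + r * y) - y / (1 + y)) =
    r * y / ((1 + r * y) * (1 + y)).
  by field; rewrite ?(gt_eqF, lt_eqF) //=; lra.
rewrite /hump ler_pdivlMr ?mulr_gt0 ?exprn_gt0 //; try lra.
rewrite mulrAC ler_pdivrMr ?exprn_gt0 //; last by lra.
have : 0 <= y * (r - 1) * (1 + y) by rewrite !mulr_ge0 //; lra.
rewrite !expr2; nra.
Qed.

Lemma sum_hump_le (r y : R) I : 1 < r -> 0 <= y ->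
  \sum_(0 <= i < I) hump (y * r ^+ i) <= r / (r - 1).
Proof.
move=> r1 y0.
have r0 : 0 <= r / (r - 1) by rewrite divr_ge0 //; lra.
have yi0 i : 0 <= y * r ^+ i by rewrite mulr_ge0 // exprn_ge0 //; lra.
apply: (@le_trans _ _ (r / (r - 1) *
    \sum_(0 <= i < I) ((y * r ^+ i.+1 / (1 + y * r ^+ i.+1)) -
                       (y * r ^+ i / (1 + y * r ^+ i))))).
  rewrite mulr_sumr; apply: ler_sum => i _.
  by rewrite (_ : y * r ^+ i.+1 = r * (y * r ^+ i)) ?hump_le_diff // exprS; ring.
rewrite (telescope_sumr (fun i => y * r ^+ i / (1 + y * r ^+ i))) //.
rewrite -[leRHS]mulr1 ler_wpM2l //.
have : 0 <= y * r ^+ 0 / (1 + y * r ^+ 0).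
  by rewrite divr_ge0 //; have := yi0 0; lra.
suff : y * r ^+ I / (1 + y * r ^+ I) <= 1 by lra.
by rewrite ler_pdivrMr; have := yi0 I; lra.
Qed.


Lemma abel_sum_le (c u : nat -> R) (m n : nat) (V : R) :
  (forall k, (m <= k)%N -> 0 <= c k) -> (forall k, (m <= k)%N -> c k.+1 <= c k) ->
  (forall L, (m <= L <= n)%N -> `|\sum_(m <= k < L) u k| <= V) -> (m <= n)%N ->
  `|\sum_(m <= k < n) c k * u k| <= c m * V.
Proof.
move=> c0 cd hV mn.
(* Subtracting [c (m + j)] times the plain partial sum leaves increments [(c k - c k.+1)] times a
   partial sum, whose bounds telescope. *)
suff h j : (m + j <= n)%N ->
    `|\sum_(m <= k < m + j) c k * u k - c (m + j)%N * \sum_(m <= k < m + j) u k|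
      <= (c m - c (m + j)%N) * V.
  have := h (n - m)%N; rewrite subnKC // => /(_ (leqnn n)) h1.
  have h2 : `|c n * \sum_(m <= k < n) u k| <= c n * V.
    by rewrite normrM ger0_norm ?c0 // ler_wpM2l ?c0 // hV // mn leqnn.
  by rewrite -[X in `|X|](subrK (c n * \sum_(m <= k < n) u k)) (le_trans (ler_normD _ _)) //; lra.
elim: j => [|j IH] hj; first by rewrite addn0 !big_geq // mulr0 !subrr mul0r normr0.
rewrite addnS !big_nat_recr ?leq_addr //=; set S1 := \sum_(_ <= _ < _) _ * _ in IH *.
set S2 := \sum_(_ <= _ < _) _ in IH *.
rewrite (_ : _ - _ = S1 - c (m + j)%N * S2 + (c (m + j)%N - c (m + j).+1) * (S2 + u (m + j)%N)); last by ring.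
apply: le_trans (ler_normD _ _) _.
rewrite (_ : (c m - _) * V = (c m - c (m + j)%N) * V + (c (m + j)%N - c (m + j).+1) * V); last by ring.
apply: lerD; first by apply: IH; lia.
have cd1 := cd (m + j)%N (leq_addr _ _).
rewrite normrM ger0_norm ?subr_ge0 // ler_wpM2l ?subr_ge0 //.
by have := hV (m + j).+1; rewrite big_nat_recr ?leq_addr //=; apply; lia.
Qed.

(** Abel summation on a piece starting at [p] in block [i] leaves the weight
    [c p * r ^ i <= c p * p <= eps]. The 2 arises because a piece that starts inside a block is a
    difference of two initial parts. *)
Lemma blockwise_tail_le (c u w : nat -> R) (r m : nat) (eps : R) I n :
  (forall k, (0 < k)%N -> 0 <= c k) -> (forall k, (0 < k)%N -> c k.+1 <= c k) ->
  (1 < r)%N -> (forall i, 0 <= w i) ->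
  (forall i L, (r ^ i <= L <= r ^ i.+1)%N ->
     `|\sum_(r ^ i <= k < L) u k| <= (r ^ i)%:R * w i) ->
  (0 < m)%N -> (forall k, (m <= k)%N -> c k * k%:R <= eps) ->
  (m <= n <= r ^ I)%N ->
  `|\sum_(m <= k < n) c k * u k| <= 2 * eps * \sum_(0 <= i < I) w i.
Proof.
move=> c0 cd r1 w0 hw m0 hm.
have eps0 : 0 <= eps by apply: le_trans (hm m (leqnn m)); rewrite mulr_ge0 ?c0.
have block i p q : (r ^ i <= p <= q)%N -> (m <= p)%N -> (q <= r ^ i.+1)%N ->
    `|\sum_(p <= k < q) c k * u k| <= 2 * eps * w i.
  move=> /andP[ip pq] mp qi; have p0 : (0 < p)%N := leq_trans m0 mp.
  apply: (@le_trans _ _ (c p * (2 * (r ^ i)%:R * w i))).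
    apply: abel_sum_le => //.
    - by move=> k pk; apply: c0; apply: leq_trans pk.
    - by move=> k pk; apply: cd; apply: leq_trans pk.
    move=> L /andP[pL Lq].
    have /= h1 := hw i L; have /= h2 := hw i p.
    have -> : \sum_(p <= k < L) u k = \sum_(r ^ i <= k < L) u k - \sum_(r ^ i <= k < p) u k.
      by rewrite (@big_cat_nat _ _ _ p (r ^ i)%N L) //=; ring.
    rewrite (le_trans (ler_normB _ _)) //.
    have {}h1 := h1 ltac:(lia); have {}h2 := h2 ltac:(lia); lra.
  rewrite [leLHS](_ : _ = 2 * (c p * (r ^ i)%:R) * w i); last by ring.
  rewrite ler_wpM2r // ler_wpM2l //; apply: le_trans (hm p mp).
  by rewrite ler_wpM2l ?c0 // ler_nat.
elim: I n => [|I IH] n /andP[mn nI].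
  by rewrite !big_geq ?normr0 ?mulr0 //; move: nI; rewrite expn0; lia.
rewrite [in leRHS]big_nat_recr //= mulrDr.
have [nI'|In] := leqP n (r ^ I).
  apply: le_trans (IH n _) _; first by rewrite mn.
  by rewrite lerDl !mulr_ge0.
have [Im|mI] := leqP (r ^ I) m.
  apply: (@le_trans _ _ (2 * eps * w I)); first by apply: block => //; rewrite Im mn.
  by rewrite lerDr !mulr_ge0 //; apply: sumr_ge0.
rewrite (@big_cat_nat _ _ _ (r ^ I)%N) //=; try exact: ltnW.
apply: le_trans (ler_normD _ _) _; apply: lerD; first by apply: IH; apply/andP; split; [exact: ltnW|exact: leqnn].
apply: block => //; last exact: ltnW.
by apply/andP; split; [exact: leqnn|exact: ltnW].
Qed.

Lemma uniform_cauchy_cvg (A : set R) (F : nat -> R -> R) :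
  (forall e, 0 < e -> exists m, forall n p x, A x -> (m <= n <= p)%N ->
     `|F p x - F n x| <= e) ->
  uniformly_convergent_on A F.
Proof.
move=> hF; exists (fun x => limn (fun n => F n x)).
have cv x : A x -> cvgn (fun n => F n x).
  move=> Ax; apply/cauchy_cvgP/cauchy_exP => e e0.
  have [m hm] := hF _ (divr_gt0 e0 (ltr0Sn _ 1)); exists (F m x); exists m => //= n mn.
  by rewrite /ball /= distrC (le_lt_trans (hm m n x Ax _)) ?leqnn //; lra.
move=> P /uniform_nbhs [E [entE subP]].
have [e e0 eE] : exists2 e : R, 0 < e & forall a b : R, `|a - b| < e -> E (a, b).
  move: entE; rewrite -entourage_ballE => -[e /= e0 h]; exists e => // a b ab.
  exact: (h (a, b)).
have [m hm] := hF _ (divr_gt0 e0 (ltr0Sn _ 2)); exists m => //= n mn.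
apply: subP => y Ay; apply: eE.
(* The index [p] depends on [y], but the detour through [F (maxn p n) y] leaves a bound that
   involves only [m]. *)
have /cvgrPdist_lt /(_ _ (divr_gt0 e0 (ltr0Sn R 1))) [p _ hp] := cv y Ay.
have /= h1 := hp _ (leq_maxl p n).
have h2 := hm n (maxn p n) y Ay ltac:(rewrite mn leq_maxr //).
by rewrite -(subrKA (F (maxn p n) y)) (le_lt_trans (ler_normD _ _)) //; lra.
Qed.

(** The majorant [w] may vary with [x]; only the bound [C] on its partial sums is uniform. *)
Theorem uniform_cvg_sine_sum (c phi : nat -> R) (A : set R) (r : nat) (C : R) :
  (forall k, (0 < k)%N -> 0 <= c k) -> (forall k, (0 < k)%N -> c k.+1 <= c k) ->
  (fun k : nat => c k * k%:R) @ \oo --> (0 : R) -> (1 < r)%N ->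
  (forall x, A x -> exists w : nat -> R, [/\ forall i, 0 <= w i,
     forall I, \sum_(0 <= i < I) w i <= C &
     forall i L, (r ^ i <= L <= r ^ i.+1)%N ->
       `|\sum_(r ^ i <= k < L) sin (phi k * x)| <= (r ^ i)%:R * w i]) ->
  uniformly_convergent_on A (sine_sum c phi).
Proof.
move=> c0 cd ck r1 hA; apply: uniform_cauchy_cvg => e e0.
have C1 : 0 < 2 * (`|C| + 1) by rewrite mulr_gt0 // ltr_wpDl.
have eps0 : 0 < e / (2 * (`|C| + 1)) by rewrite divr_gt0.
have /cvgrPdist_lt /(_ _ eps0) [m _ hm] := ck; exists m => n p x Ax /andP[mn np].
have [w [w0 wC hw]] := hA x Ax.
rewrite /sine_sum /series1 (@big_cat_nat _ _ _ n.+1 1 p.+1) //= addrAC subrr add0r.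
have -> : e = 2 * (e / (2 * (`|C| + 1))) * (`|C| + 1).
  by field; rewrite gt_eqF // ltr_wpDl.
(* The number of blocks is immaterial; [p.+1] of them suffice since [p.+1 <= r ^ p.+1]. *)
apply: (le_trans (@blockwise_tail_le _ _ w r n.+1 _ p.+1 p.+1 c0 cd r1 w0 hw _ _ _)) => //.
- move=> k nk; have := hm k _; rewrite /= sub0r normrN => h.
  apply: le_trans (ler_norm _) (ltW (h _)).
  by apply: leq_trans nk; apply: ltnW; rewrite ltnS.
- by rewrite ltnS np ltnW // ltn_expl.
apply: ler_wpM2l; first by rewrite mulr_ge0 // ltW.
by apply: le_trans (wC _) (le_trans (ler_norm _) _); rewrite lerDl.
Qed.

End BlockCriterion.

(** * Sums of sines with monotone or convex phases *)

Section TrigSums.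
Context {R : realType}.
Implicit Types (g : nat -> R).

Lemma sin_le_id (x : R) : 0 <= x -> sin x <= x.
Proof.
rewrite le_eqVlt => /orP[/eqP<-|x0]; first by rewrite sin0.
have [y _] := @MVT R (@sin R) cos 0 x x0 (fun y _ => is_derive_sin y)
  (continuous_subspaceT (@continuous_sin R)).
rewrite sin0 !subr0 => ->; rewrite -[leRHS]mul1r ler_wpM2r ?cos_le1 //; exact: ltW.
Qed.

Lemma normr_sin_le (x : R) : `|sin x| <= `|x|.
Proof.
wlog x0 : x / 0 <= x.
  move=> h; have [|/ltW xn] := leP 0 x; first exact: h.
  by rewrite -normrN -sinN -(normrN x) h // oppr_ge0.
rewrite (ger0_norm x0); have [x1|x1] := leP x 1.
  by rewrite ger0_norm ?sin_le_id // sin_ge0_pi // x0 /=; have := pi_ge2 R; lra.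
exact: le_trans (sin_max x) (ltW x1).
Qed.

(** By halving: [sin x = 2 cos (x/2) sin (x/2)], the mean value theorem gives
    [sin (x/2) = cos y * (x/2)] with [cos y >= cos (x/2)], and
    [2 cos (x/2) ^ 2 = 1 + cos x >= 1]. *)
Lemma sin_ge_half (x : R) : 0 <= x <= pi / 2 -> x / 2 <= sin x.
Proof.
move=> /andP[]; rewrite le_eqVlt => /orP[/eqP<-|x0] xp; first by rewrite sin0 mul0r.
have x20 : 0 < x / 2 by lra.
have p2 := pi_ge2 R.
have [y] := @MVT R (@sin R) cos 0 (x / 2) x20 (fun y _ => is_derive_sin y)
  (continuous_subspaceT (@continuous_sin R)).
rewrite in_itv /= sin0 !subr0 => /andP[y0 yx] e.
have xE : x = (x / 2) *+ 2 by rewrite -mulr_natl; field.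
have -> : sin x = 2 * (cos (x / 2) * (cos y * (x / 2))).
  by rewrite {1}xE sin_mulr2n e mulr_natl.
have cy : cos (x / 2) <= cos y.
  by rewrite ltW // ltr_cos // ?in_itv /=; lra.
have c0 : 0 <= cos (x / 2) by apply: cos_ge0_pihalf; lra.
have : 1 <= 2 * cos (x / 2) ^+ 2.
  have -> : 2 * cos (x / 2) ^+ 2 = cos x + 1.
    by rewrite [in RHS]xE cos_mulr2n mulr_natl subrK.
  by rewrite lerDr; apply: cos_ge0_pihalf; lra.
rewrite expr2 => h.
have : cos (x / 2) * cos (x / 2) <= cos (x / 2) * cos y by apply: ler_wpM2l.
rewrite [cos (x / 2) * (_ * _)]mulrA.
move: (cos (x / 2) * cos (x / 2)) h => u h1.
move: (cos (x / 2) * cos y) => v h2.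
have : 0 <= x / 2 * (v - 1 / 2) by apply: mulr_ge0; lra.
lra.
Qed.

Lemma sin_ge_between (th y : R) : 0 < th -> th <= y <= pi - th -> th / 2 <= sin y.
Proof.
move=> t0 /andP[ty yp]; have [yh|yh] := leP y (pi / 2).
  have : y / 2 <= sin y by apply: sin_ge_half; lra.
  lra.
have : (pi - y) / 2 <= sin (pi - y) by apply: sin_ge_half; lra.
by rewrite sinB sinpi cospi; lra.
Qed.

(** Summation by parts moves the differences onto [w], whose total variation is at most [2 * M]; the
    two boundary terms give the other [2 * M]. *)
Lemma sum_monotone_weights_le (w v : nat -> R) p q (M : R) :
  (forall k, (p <= k)%N -> (k.+1 < q)%N -> w k.+1 <= w k) ->
  (forall k, (p <= k < q)%N -> `|w k| <= M) -> (forall k, `|v k| <= 1) -> 0 <= M ->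
  `|\sum_(p <= k < q) w k * (v k - v k.+1)| <= 4 * M.
Proof.
move=> wd wM v1 M0; have [qp|pq] := leqP q p.
  by rewrite big_geq // normr0 mulr_ge0.
suff h n : (p + n < q)%N ->
    `|\sum_(p <= k < (p + n).+1) w k * (v k - v k.+1) + w (p + n)%N * v (p + n).+1 - w p * v p|
     <= w p - w (p + n)%N.
  have /= := h (q - p).-1; rewrite (_ : (p + (q - p).-1)%N = q.-1); last by lia.
  rewrite (_ : q.-1.+1 = q); last by lia.
  move=> /(_ ltac:(lia)); set S := \sum_(_ <= _ < _) _ => hS.
  have w1 := wM p ltac:(lia); have w2 := wM q.-1 ltac:(lia).
  have a1 : `|w p * v p| <= M by rewrite normrM -[leRHS]mulr1 ler_pM.
  have a2 : `|w q.-1 * v q| <= M by rewrite normrM -[leRHS]mulr1 ler_pM.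
  move: hS w1 w2 a1 a2; rewrite !ler_norml; lra.
elim: n => [|n IH] h.
  by rewrite addn0 big_nat1 (_ : _ - _ = 0) ?normr0 ?subrr //; ring.
rewrite big_nat_recr /=; last by rewrite (leq_trans (leq_addr n.+1 p)).
rewrite addnS in h *; set S := \sum_(_ <= _ < _) _ in IH *.
rewrite [X in `|X|](_ : _ = (S + w (p + n)%N * v (p + n).+1 - w p * v p)
   + (w (p + n).+1 - w (p + n)%N) * v (p + n).+1); last by ring.
have d := wd (p + n)%N (leq_addr _ _) h.
have : `|(w (p + n).+1 - w (p + n)%N) * v (p + n).+1| <= w (p + n)%N - w (p + n).+1.
  rewrite normrM distrC [`|w _ - _|]ger0_norm ?subr_ge0 //.
  by apply: ler_piMr; rewrite ?subr_ge0.
have := IH (ltnW h); have := ler_normD (S + w (p + n)%N * v (p + n).+1 - w p * v p)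
  ((w (p + n).+1 - w (p + n)%N) * v (p + n).+1).
lra.
Qed.

Let cot (x : R) := cos x / sin x.

(* With a_k = g (k+1) - g k, summation by parts applies after writing
   2 sin g_k = sin g_k - sin g_(k+1) + cot (a_k / 2) (cos g_k - cos g_(k+1)). *)
Lemma kuzmin_landau g p q th : 0 < th ->
  (forall k, (p <= k < q)%N -> th <= g k.+1 - g k <= 2 * pi - th) ->
  (forall k, (p <= k)%N -> (k.+1 < q)%N -> g k.+1 - g k <= g k.+2 - g k.+1) ->
  `|\sum_(p <= k < q) sin (g k)| <= 1 + 8 / th.
Proof.
move=> t0 hth mono.
have [qp|pq] := leqP q p.
  by rewrite big_geq // normr0 addr_ge0 // divr_ge0 // ltW.
pose a k := (g k.+1 - g k) / 2.
have sa k : (p <= k < q)%N -> th / 4 <= sin (a k).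
  move=> /hth h; have : th / 2 / 2 <= sin (a k).
    by apply: sin_ge_between; rewrite /a; lra.
  lra.
have sa0 k : (p <= k < q)%N -> 0 < sin (a k) by move=> /sa; apply: lt_le_trans; lra.
have E : 2 * \sum_(p <= k < q) sin (g k) = (sin (g p) - sin (g q)) +
    \sum_(p <= k < q) cot (a k) * (cos (g k) - cos (g k.+1)).
  rewrite -(opprB (sin (g q))) -(telescope_sumr (fun k => sin (g k)) (ltnW pq)).
  rewrite -sumrN -big_split /= mulr_sumr; apply: eq_big_nat => k kpq.
  have s0 := sa0 k kpq.
  have [m -> ->] : exists2 m, g k = m - a k & g k.+1 = m + a k.
    by exists (g k + a k); rewrite /a; field.
  rewrite !(sinB, cosB, sinD, cosD) /cot.
  by field; rewrite gt_eqF.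
have M0 : 0 <= 4 / th by rewrite divr_ge0 // ltW.
(* Here [|cot (a k)| <= 4 / th] because [sin (a k) >= th / 4]. Halving at the end turns [16 / th]
   into [8 / th], and the two end sines into 1. *)
have : `|\sum_(p <= k < q) cot (a k) * (cos (g k) - cos (g k.+1))| <= 4 * (4 / th).
  apply: (@sum_monotone_weights_le (fun k => cot (a k)) (fun k => cos (g k))) => //.
  (* The cotangent decreases: after clearing denominators the claim is [sin (a k.+1 - a k) >= 0]. *)
  - move=> k pk kq; rewrite /cot ler_pdivrMr ?sa0 //; last by lia.
    rewrite mulrAC ler_pdivlMr ?sa0 //; last by lia.
    rewrite -subr_ge0 [cos (a k) * _]mulrC -sinB sin_ge0_pi //.
    have := mono k pk kq; have := hth k ltac:(lia); have := hth k.+1 ltac:(lia).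
    by rewrite /a; lra.
  - move=> k kpq; rewrite /cot normrM normfV (gtr0_norm (sa0 k kpq)).
    rewrite ler_pdivrMr ?sa0 //; apply: le_trans (cos_max _) _.
    have := ler_wpM2l M0 (sa k kpq); apply: le_trans.
    by rewrite le_eqVlt; apply/orP; left; apply/eqP; field; rewrite gt_eqF.
  - by move=> k; exact: cos_max.
have := sin_max (g p); have := sin_max (g q); move: E.
rewrite (_ : 4 * (4 / th) = 2 * (8 / th)); last by field; rewrite gt_eqF.
move: (\sum_(_ <= _ < _) cot _ * _) => S2 E; rewrite !ler_norml; lra.
Qed.

(** Subtracting [2 * pi * j * k] from the phase alters no sine and moves the increments to the first
    window. *)
Lemma kuzmin_landau_mod (j : nat) g p q th : 0 < th ->
  (forall k, (p <= k < q)%N ->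
     j%:R * (2 * pi) + th <= g k.+1 - g k <= j.+1%:R * (2 * pi) - th) ->
  (forall k, (p <= k)%N -> (k.+1 < q)%N -> g k.+1 - g k <= g k.+2 - g k.+1) ->
  `|\sum_(p <= k < q) sin (g k)| <= 1 + 8 / th.
Proof.
move=> t0 hth mono; pose g' k := g k - (j * k)%:R * (2 * pi).
have -> : \sum_(p <= k < q) sin (g k) = \sum_(p <= k < q) sin (g' k).
  by apply: eq_bigr => k _; rewrite -(sin_natpi2 (j * k) (g' k)) subrK.
have g'E k : g' k.+1 - g' k = g k.+1 - g k - j%:R * (2 * pi).
  by rewrite /g' mulnS natrD; ring.
apply: kuzmin_landau => // k; rewrite !g'E.
  by move=> /hth; rewrite -natr1 mulrDl; lra.
by move=> pk kq; have := mono k pk kq; lra.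
Qed.

Lemma split_monotone (a : nat -> R) p q t : (p <= q)%N ->
  (forall k, (p <= k)%N -> (k.+1 < q)%N -> a k <= a k.+1) ->
  exists s, [/\ (p <= s <= q)%N, forall k, (p <= k < s)%N -> a k < t &
    forall k, (s <= k < q)%N -> t <= a k].
Proof.
elim: q => [|q IH] pq mono.
  by exists p; split => [|k|k]; lia.
move: pq; rewrite leq_eqVlt => /orP[/eqP<-|pq]; first by exists p; split => [|k|k]; lia.
have [s [h1 h2 h3]] := IH pq ltac:(by move=> k pk kq; apply: mono => //; lia).
have [tq|qt] := leP t (a q).
  exists s; split => //; [lia|move=> k /andP[sk]; rewrite ltnS leq_eqVlt => /orP[/eqP->//|kq]].
  by apply: h3; rewrite sk.
exists q.+1; split; [lia| |by move=> k; lia].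
move=> k /andP[pk]; rewrite ltnS leq_eqVlt => /orP[/eqP->//|kq].
have [ks|sk] := ltnP k s; first by apply: h2; rewrite pk.
suff : a k <= a q by move=> /le_lt_trans; apply.
have h n : (k + n <= q)%N -> a k <= a (k + n)%N.
  elim: n => [|n IHn] hn; first by rewrite addn0.
  rewrite addnS in hn *; apply: le_trans (IHn (ltnW hn)) (mono _ _ _); lia.
by have := h (q - k)%N; rewrite subnKC ?leqnn; [apply|exact: ltnW].
Qed.

Lemma norm_sum_sin_le g p q : `|\sum_(p <= k < q) sin (g k)| <= (q - p)%:R.
Proof.
apply: le_trans (ler_norm_sum _ _ _) _.
rewrite -[(q - p)%N]muln1 -sum_nat_const_nat natr_sum.
by apply: ler_sum => k _; exact: sin_max.
Qed.

Lemma spaced_count_le (a : nat -> R) p q x th lam : 0 < lam -> 0 <= th ->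
  (forall k, (p <= k)%N -> (k.+1 < q)%N -> a k + lam <= a k.+1) ->
  (forall k, (p <= k < q)%N -> x <= a k <= x + th) ->
  (q - p)%:R <= th / lam + 1.
Proof.
move=> l0 th0 inc hx; have [qp|pq] := leqP q p.
  by rewrite (_ : (q - p)%N = 0)%N ?addr_ge0 ?divr_ge0 // ?ltW //; lia.
have h n : (p + n < q)%N -> a p + n%:R * lam <= a (p + n)%N.
  elim: n => [|n IHn] hn; first by rewrite addn0 mul0r addr0.
  rewrite addnS in hn *; have := IHn (ltnW hn); have := inc (p + n)%N (leq_addr _ _) hn.
  by rewrite -natr1; lra.
have := h (q - p).-1; have := hx p ltac:(lia); have := hx q.-1 ltac:(lia).
rewrite (_ : (p + (q - p).-1)%N = q.-1); last by lia.
move=> h1 h2 /(_ ltac:(lia)) h3.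
rewrite (_ : (q - p)%N = (q - p).-1.+1)%N; last by lia.
by rewrite -natr1 lerD2r ler_pdivlMr //; lra.
Qed.

(** * Van der Corput's second difference test *)

Section Windows.
Variables (g : nat -> R) (lam : R).
Let a k := g k.+1 - g k.
Hypothesis lam0 : 0 < lam.
Let s := Num.sqrt lam.
Let B := 10 / s + 3.

(** Cutting at distance [s = sqrt lam] from the window's ends balances the two estimates. Increments
    grow by at least [lam], so each end strip holds at most [s / lam + 1 = 1 / s + 1] indices,
    estimated trivially; the middle contributes [1 + 8 / s]. *)
Lemma second_difference_window (j : nat) p q : (p <= q)%N ->
  (forall k, (p <= k)%N -> (k.+1 < q)%N -> a k + lam <= a k.+1) ->
  (forall k, (p <= k < q)%N -> j%:R * (2 * pi) <= a k < j.+1%:R * (2 * pi)) ->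
  `|\sum_(p <= k < q) sin (g k)| <= B.
Proof.
move=> pq inc win.
have s0 : 0 < s by rewrite sqrtr_gt0.
have lamE : lam = s * s by rewrite -expr2 sqr_sqrtr // ltW.
have mono p' q' : (p <= p')%N -> (q' <= q)%N ->
    forall k, (p' <= k)%N -> (k.+1 < q')%N -> a k <= a k.+1.
  move=> pp qq k pk kq; apply: le_trans (inc k _ _); rewrite ?lerDl ?ltW //; lia.
have [u [pu h1 h2]] := @split_monotone a p q (j%:R * (2 * pi) + s) pq (mono p q (leqnn _) (leqnn _)).
have [v [uv h3 h4]] := @split_monotone a u q (j.+1%:R * (2 * pi) - s) ltac:(lia)
   (mono u q ltac:(lia) (leqnn _)).
have quot : s / lam = 1 / s by rewrite lamE; field; rewrite gt_eqF.
have c1 : (u - p)%:R <= 1 / s + 1.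
  rewrite -quot; apply: (@spaced_count_le a _ _ (j%:R * (2 * pi))) => //; first exact: ltW.
    by move=> k pk ku; apply: inc; lia.
  move=> k kpu; have := h1 k kpu; have := win k ltac:(lia).
  by move=> /andP[-> _] /ltW ->.
have c3 : (q - v)%:R <= 1 / s + 1.
  rewrite -quot; apply: (@spaced_count_le a _ _ (j.+1%:R * (2 * pi) - s)) => //; first exact: ltW.
    by move=> k pk ku; apply: inc; lia.
  move=> k kvq; have := h4 k kvq; have := win k ltac:(lia).
  by move=> /andP[_ /ltW]; lra.
have c2 : `|\sum_(u <= k < v) sin (g k)| <= 1 + 8 / s.
  apply: (@kuzmin_landau_mod j) => //; last first.
    by apply: mono; lia.
  move=> k kuv; have := h2 k ltac:(lia); have := h3 k kuv; rewrite /a.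
  by move=> /ltW -> ->.
rewrite (@big_cat_nat _ _ _ u) //=; [|lia|lia].
rewrite (@big_cat_nat _ _ _ v u q) //=; [|lia|lia].
have n1 := norm_sum_sin_le g p u; have n3 := norm_sum_sin_le g v q.
apply: le_trans (ler_normD _ _) _.
have := ler_normD (\sum_(u <= k < v) sin (g k)) (\sum_(v <= k < q) sin (g k)).
rewrite /B; lra.
Qed.

Lemma second_difference_windows (W : nat) p q : (p <= q)%N ->
  (forall k, (p <= k)%N -> (k.+1 < q)%N -> a k + lam <= a k.+1) ->
  (forall k, (p <= k < q)%N -> 0 <= a k < W%:R * (2 * pi)) ->
  `|\sum_(p <= k < q) sin (g k)| <= W%:R * B.
Proof.
elim: W q => [|W IH] q pq inc win.
  rewrite big_nat big_pred0 ?normr0 ?mul0r // => k; apply/negP => /win.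
  by rewrite mul0r => /andP[/le_lt_trans h /h]; rewrite ltxx.
have [u [pu h1 h2]] := @split_monotone a p q (W%:R * (2 * pi)) pq
   ltac:(by move=> k pk kq; apply: le_trans (inc k pk kq); rewrite lerDl ltW).
rewrite (@big_cat_nat _ _ _ u) //=; [|lia|lia].
rewrite -natr1 mulrDl mul1r; apply: le_trans (ler_normD _ _) (lerD _ _).
  apply: IH; first lia.
    by move=> k pk ku; apply: inc; lia.
  by move=> k kpu; rewrite h1 // andbT; case/andP: (win k ltac:(lia)).
apply: (@second_difference_window W); first lia.
  by move=> k pk ku; apply: inc; lia.
by move=> k kuq; rewrite h2 //=; case/andP: (win k ltac:(lia)).
Qed.

End Windows.

Lemma second_difference_test g (lam V : R) p q : 0 < lam -> (p <= q)%N ->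
  (forall k, (p <= k)%N -> (k.+1 < q)%N ->
     g k.+1 - g k + lam <= g k.+2 - g k.+1) ->
  0 <= V -> (forall k, (p <= k < q)%N -> `|g k.+1 - g k| <= V) ->
  `|\sum_(p <= k < q) sin (g k)| <= (V + 3) * (10 / Num.sqrt lam + 3).
Proof.
move=> lam0 pq inc V0 hV; have s0 : 0 < Num.sqrt lam by rewrite sqrtr_gt0.
have p2 := pi_ge2 R.
(* Adding [J] full turns per step makes all increments nonnegative and confines them to [2 * J]
   windows; [2 * J <= V / 2 + 2] because [pi >= 2]. *)
pose J := (Num.truncn (V / (2 * pi))).+1.
have J1 : V < J%:R * (2 * pi).
  by rewrite -ltr_pdivrMr; [exact: truncnS_gt|lra].
have J2 : J%:R <= V / (2 * pi) + 1.
  by rewrite /J -natr1 lerD2r truncn_le divr_ge0 //; lra.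
have J3 : V / (2 * pi) <= V / 4.
  by rewrite ler_wpM2l // lef_pV2 ?posrE; lra.
pose g' k := g k + (J * k)%:R * (2 * pi).
have -> : \sum_(p <= k < q) sin (g k) = \sum_(p <= k < q) sin (g' k).
  by apply: eq_bigr => k _; rewrite sin_natpi2.
have g'E k : g' k.+1 - g' k = g k.+1 - g k + J%:R * (2 * pi).
  by rewrite /g' mulnS natrD; ring.
apply: (@le_trans _ _ ((J + J)%:R * (10 / Num.sqrt lam + 3))).
  apply: second_difference_windows => // k; rewrite !g'E.
    by move=> pk kq; have := inc k pk kq; lra.
  by move=> /hV; rewrite natrD ler_norml => /andP[]; lra.
rewrite ler_wpM2r ?addr_ge0 ?divr_ge0 //.
by rewrite natrD; lra.
Qed.

End TrigSums.

(** * Linear phases and real powers *)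

Section PowerPhases.
Context {R : realType}.

(** The 4 comes from [(1 + y) ^ 2 <= 4] for [y <= 1] and [(1 + y) ^ 2 <= 4 * y ^ 2] for [y >= 1]. *)
Lemma le_hump (A v y : R) : 0 <= A -> 0 <= y -> (y <= 1 -> v <= A * y) ->
  (1 <= y -> v <= A / y) -> v <= 4 * A * hump y.
Proof.
move=> A0 y0 h1 h2; rewrite /hump; have [y1|y1] := leP y 1.
  apply: le_trans (h1 y1) _; rewrite -mulrA [leRHS](_ : _ = A * (4 * y / (1 + y) ^+ 2)); last by ring.
  rewrite ler_wpM2l // ler_pdivlMr ?exprn_gt0 //; last by lra.
  by rewrite mulrC ler_wpM2r // expr2; nra.
apply: le_trans (h2 (ltW y1)) _.
have yp : 0 < y by apply: lt_trans y1.
rewrite [leRHS](_ : _ = A * (4 * y / (1 + y) ^+ 2)); last by ring.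
rewrite ler_wpM2l // ler_pdivlMr ?exprn_gt0 //; last by lra.
by rewrite mulrC ler_pdivrMr // expr2; nra.
Qed.

Lemma norm_sum_sin_norm (h : nat -> R) (z : R) p q :
  `|\sum_(p <= k < q) sin (h k * z)| = `|\sum_(p <= k < q) sin (h k * `|z|)|.
Proof.
have [z0|z0] := leP 0 z; first by rewrite (ger0_norm z0).
rewrite (ltr0_norm z0) -normrN -sumrN; congr `|_|.
by apply: eq_bigr => k _; rewrite -sinN mulrN.
Qed.

Lemma norm_sum_sin_small (g : nat -> R) p q V :
  (forall k, (p <= k < q)%N -> `|g k| <= V) ->
  `|\sum_(p <= k < q) sin (g k)| <= (q - p)%:R * V.
Proof.
move=> hV; apply: le_trans (ler_norm_sum _ _ _) _.
rewrite -[(q - p)%N]muln1 -sum_nat_const_nat natr_sum mulr_suml.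
rewrite big_nat [leRHS]big_nat; apply: ler_sum => k kpq; rewrite mul1r.
exact: le_trans (normr_sin_le _) (hV k kpq).
Qed.

Lemma linear_block_le (z : R) (N L : nat) : (N <= L <= N * 2)%N -> (0 < N)%N ->
  0 <= z <= 1 / 2 ->
  `|\sum_(N <= k < L) sin (k%:R * (2 * pi * z))| <= N%:R * (64 * hump (z * N%:R)).
Proof.
move=> /andP[NL LN] N0 /andP[z0 z1].
have p2 := pi_ge2 R; have p4 : pi <= 4 :> R by have := @pihalf_lt2 R; lra.
have NR : 0 < N%:R :> R by rewrite ltr0n.
rewrite [leRHS]mulrC -ler_pdivrMr // (_ : 64 = 4 * 16 :> R); last by ring.
apply: le_hump => //; first by rewrite mulr_ge0 // ltW.
  move=> _; rewrite ler_pdivrMr //.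
  apply: (@le_trans _ _ ((L - N)%:R * (16 * (z * N%:R)))).
    apply: norm_sum_sin_small => k kNL.
    have -> : 16 * (z * N%:R) = (N * 2)%:R * (8 * z) by rewrite natrM; ring.
    rewrite normrM [`|k%:R|]normr_nat ler_pM //; first by rewrite ler_nat; lia.
    by rewrite ger0_norm ?mulr_ge0 //; nra.
  rewrite mulrC ler_wpM2l ?mulr_ge0 //.
  by rewrite ler_nat; lia.
move=> h; have zp : 0 < z.
  by rewrite lt_neqAle z0 andbT; apply/eqP => z00; move: h; rewrite -z00 mul0r; lra.
have th0 : 0 < 2 * pi * z by rewrite mulr_gt0 //; lra.
rewrite ler_pdivrMr // invfM mulrA -[16 / z / N%:R * N%:R]mulrA mulVf ?mulr1; last by rewrite gt_eqF.
apply: (@le_trans _ _ (1 + 8 / (2 * pi * z))).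
  (* The increment is constantly [2 * pi * z], which serves as [th]; [z <= 1 / 2] is exactly what
     keeps it below [2 * pi - th]. *)
  apply: kuzmin_landau => // k; rewrite -!natr1; first by move=> _; nra.
  by move=> _ _; lra.
have : 8 / (2 * pi * z) <= 2 / z.
  rewrite (_ : 2 / z = 8 / (4 * z)); last by field; rewrite gt_eqF.
  by rewrite ler_wpM2l // lef_pV2 ?posrE ?mulr_gt0 //; nra.
have : 1 <= 1 / z by rewrite ler_pdivlMr //; lra.
by rewrite -[2 / z]mulrC -[16 / z]mulrC -[1 / z]mulrC; lra.
Qed.

Lemma nearest_int (t : R) : exists a : int, `|t - a%:~R| <= 1 / 2.
Proof.
exists (Num.floor (t + 1 / 2)); have /andP[] := floor_itv (t + 1 / 2).
by rewrite intrD ler_norml; lra.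
Qed.

(** Linear phases have no second difference to exploit, hence this separate case. As [k] is an
    integer, [x / (2 * pi)] matters only modulo 1. *)
Lemma linear_blocks (x : R) : exists w : nat -> R, [/\ forall i, 0 <= w i,
     forall I, \sum_(0 <= i < I) w i <= 128 &
     forall i L, (2 ^ i <= L <= 2 ^ i.+1)%N ->
       `|\sum_(2 ^ i <= k < L) sin (k%:R * x)| <= (2 ^ i)%:R * w i].
Proof.
have [a ha] := nearest_int (x / (2 * pi)); set z := x / (2 * pi) - a%:~R in ha.
have p2 := pi_ge2 R.
exists (fun i => 64 * hump (`|z| * 2 ^+ i)); split.
- by move=> i; rewrite mulr_ge0 // hump_ge0 // mulr_ge0 // exprn_ge0.
- move=> I; rewrite -mulr_sumr (_ : 128 = 64 * (2 / (2 - 1)) :> R); last by field.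
  by rewrite ler_wpM2l // sum_hump_le // ltr1n.
move=> i L; rewrite expnSr => hL.
have -> : \sum_(2 ^ i <= k < L) sin (k%:R * x) = \sum_(2 ^ i <= k < L) sin (k%:R * (2 * pi * z)).
  apply: eq_bigr => k _; rewrite -[RHS](sin_intpi2 (k%:Z * a)); congr sin.
  by rewrite intrM -pmulrn /z; field; lra.
rewrite norm_sum_sin_norm normrM ger0_norm; last by lra.
by rewrite -natrX; apply: linear_block_le => //; rewrite ?expn_gt0 // normr_ge0.
Qed.

Lemma powR_forward_difference (alpha a : R) : 0 < a ->
  exists2 s, a < s < a + 1 & (a + 1) `^ alpha - a `^ alpha = alpha * s `^ (alpha - 1).
Proof.
move=> a0; have [] := @MVT R (fun t => t `^ alpha) (fun t => alpha * t `^ (alpha - 1)) a (a + 1).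
- by rewrite ltrDl.
- by move=> s; rewrite in_itv /= => /andP[sa _]; apply: is_derive1_powR; lra.
- apply: derivable_within_continuous => s; rewrite in_itv /= => /andP[sa _].
  by apply: derivable_powR; rewrite in_itv /= andbT; lra.
by move=> s; rewrite in_itv /= addrAC subrr add0r mulr1 => hs e; exists s.
Qed.

Lemma powR_second_difference (alpha a : R) : 0 < a ->
  exists2 u, a < u < a + 2 &
    ((a + 2) `^ alpha - (a + 1) `^ alpha) - ((a + 1) `^ alpha - a `^ alpha) =
    alpha * (alpha - 1) * u `^ (alpha - 2).
Proof.
move=> a0.
pose h t := (t + 1) `^ alpha - t `^ alpha.
pose dh t := alpha * (t + 1) `^ (alpha - 1) - alpha * t `^ (alpha - 1).
have d (s : R) : 0 < s -> is_derive s 1 h (dh s).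
  move=> s0; apply: is_deriveB; last exact: is_derive1_powR.
  rewrite -[alpha * (s + 1) `^ _]mulr1.
  apply: (@is_derive1_comp R (fun t => t `^ alpha) (fun t => t + 1)).
    by apply: is_derive1_powR; rewrite addr_gt0.
  by rewrite -[X in is_derive _ _ _ X]addr0; apply: is_deriveD.
have [] := @MVT R h dh a (a + 1).
- by rewrite ltrDl.
- by move=> s; rewrite in_itv /= => /andP[sa _]; apply: d; lra.
- apply: derivable_within_continuous => s; rewrite in_itv /= => /andP[sa _].
  by have [] := d s ltac:(lra).
move=> s; rewrite in_itv /= (_ : a + 1 - a = 1); last by ring.
rewrite mulr1 /h /dh => /andP[sa s1] e.
have [u hu eu] := @powR_forward_difference (alpha - 1) s ltac:(lra).
exists u; first by lra.
have -> : a + 2 = a + 1 + 1 by ring.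
rewrite e -mulrBr eu mulrA; congr (_ * _ `^ _); ring.
Qed.


Lemma ltr_powR_base2 (a b : R) : a < b -> 2 `^ a < 2 `^ b.
Proof.
by move=> ab; rewrite /powR pnatr_eq0 /= ltr_expR ltr_pM2r // ln_gt0 // ltr1n.
Qed.

(** Written as a square, it makes [sqrt (X * N ^ alpha)] a geometric progression in [i], the input
    of [sum_hump_le]. *)
Lemma powR_nat_double (alpha : R) i : ((2 ^ i)%:R : R) `^ alpha = (2 `^ (alpha / 2)) ^+ i ^+ 2.
Proof.
rewrite natrX -powR_mulrn // -powRrM mulrC.
have -> : alpha * i%:R = alpha / 2 * (i * 2)%:R by rewrite natrM; field.
by rewrite powRrM powR_mulrn ?powR_ge0 // exprM.
Qed.

(** Since [u] lies in [[N, 4 * N]], a factor [4 ^ |beta|] covers both signs of [beta]. *)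
Lemma powR_dyadic_bounds (N k : nat) (u beta : R) : (0 < N)%N -> (N <= k)%N -> (k < N * 2)%N ->
  k%:R < u -> u < k%:R + 2 ->
  N%:R `^ beta * (4 `^ (- `|beta|)) <= u `^ beta <= N%:R `^ beta * (4 `^ `|beta|).
Proof.
move=> N0 Nk kN ku uk.
have NR : 1 <= N%:R :> R by rewrite ler1n.
have NkR : N%:R <= k%:R :> R by rewrite ler_nat.
have kNR : k%:R + 1 <= 2 * N%:R :> R by rewrite natr1 -natrM ler_nat mulnC.
have [b0|b0] := leP 0 beta.
  rewrite ger0_norm //; apply/andP; split.
    apply: (@le_trans _ _ (N%:R `^ beta)).
      rewrite -[leRHS]mulr1 ler_wpM2l ?powR_ge0 // powRN invf_le1 ?powR_gt0 //.
      by rewrite -[leLHS](powRr0 4) ler_powR //; lra.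
    by apply: ge0_ler_powR; rewrite // ?nnegrE; lra.
  rewrite -powRM //.
  by apply: ge0_ler_powR; rewrite // ?nnegrE; lra.
rewrite ltr0_norm // opprK.
have E v : v `^ beta = (v `^ (- beta))^-1 by rewrite -powRN opprK.
rewrite -powRM //.
apply/andP; split.
  rewrite E [leRHS]E lef_pV2 ?posrE ?powR_gt0 //; try lra.
  by apply: ge0_ler_powR; rewrite // ?nnegrE; lra.
apply: (@le_trans _ _ (N%:R `^ beta)).
  rewrite E [leRHS]E lef_pV2 ?posrE ?powR_gt0 //; try lra.
  by apply: ge0_ler_powR; rewrite // ?nnegrE; lra.
rewrite -[leLHS]mulr1 ler_wpM2l ?powR_ge0 //.
by rewrite -[leLHS](powRr0 4) ler_powR //; lra.
Qed.

(** * Real powers with exponent other than 1 *)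

Section PowerPhase.
Variables (alpha : R).
Hypotheses (al0 : 0 < alpha) (al2 : alpha < 2) (al1 : alpha != 1).

(** Normalised so that [kappa * s / N] is the square root of a lower bound for the second
    differences; 16 bounds [4 ^ |alpha - 2|]. *)
Let kappa := Num.sqrt (`|alpha * (alpha - 1)| / 16).

Let kappa_gt0 : 0 < kappa.
Proof.
rewrite sqrtr_gt0 divr_gt0 // normr_gt0 mulf_neq0 ?subr_eq0 //.
by rewrite gt_eqF.
Qed.

Lemma power_block_le (X : R) (N L : nat) : 0 < X -> (0 < N)%N -> (N <= L <= N * 2)%N ->
  let s := Num.sqrt (X * N%:R `^ alpha) in
  `|\sum_(N <= k < L) sin (k%:R `^ alpha * X)| <=
    N%:R * ((8 * (s ^+ 2 / N%:R) + 3) * (10 / (kappa * s) + 3 / N%:R)).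
Proof.
move=> X0 N0 /andP[NL LN] /=; set s := Num.sqrt _.
have [ha0 ha2] := (al0, al2).
have NR : 1 <= N%:R :> R by rewrite ler1n.
have NR0 : 0 < N%:R :> R by rewrite ltr0n.
have Na0 : 0 < N%:R `^ alpha by rewrite powR_gt0.
have s0 : 0 < s by rewrite sqrtr_gt0 mulr_gt0.
have s2 : s ^+ 2 = X * N%:R `^ alpha by rewrite sqr_sqrtr // ltW // mulr_gt0.
pose lam := (kappa * s / N%:R) ^+ 2.
have lam0 : 0 < lam by rewrite exprn_gt0 // divr_gt0 // mulr_gt0.
have lamE : lam = X * (`|alpha * (alpha - 1)| / 16) * N%:R `^ (alpha - 2).
  rewrite /lam expr_div_n exprMn s2 /kappa sqr_sqrtr ?divr_ge0 //.
  have -> : N%:R `^ (alpha - 2) = N%:R `^ alpha / N%:R ^+ 2.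
    by rewrite powRB ?powR_mulrn // (gt_eqF NR0) implybT.
  ring.
(* For [alpha < 1] the phase is concave; the sign makes its second differences positive and leaves
   the absolute value of the sum unchanged. *)
pose sg := Num.sg (alpha - 1).
have sgE : sg * (alpha - 1) = `|alpha - 1| by rewrite [RHS]normrEsg.
pose g (k : nat) := sg * (k%:R `^ alpha * X).
have sg1 : `|sg| = 1 by rewrite normr_sg subr_eq0 al1.
have -> : `|\sum_(N <= k < L) sin (k%:R `^ alpha * X)| = `|\sum_(N <= k < L) sin (g k)|.
  rewrite -[LHS]mul1r -[X in X * _ = _]sg1 -normrM mulr_sumr; congr `|_|; apply: eq_bigr => k _.
  by rewrite /g sin_sg.
have -> : N%:R * ((8 * (s ^+ 2 / N%:R) + 3) * (10 / (kappa * s) + 3 / N%:R)) =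
   (8 * (s ^+ 2 / N%:R) + 3) * (10 / Num.sqrt lam + 3).
  rewrite sqrtr_sqr gtr0_norm; last by rewrite divr_gt0 // mulr_gt0.
  by field; rewrite !gt_eqF.
apply: second_difference_test => //.
- move=> k Nk kL; have kR : 0 < k%:R :> R by rewrite ltr0n (leq_trans N0).
  have [u /andP[hu1 hu2] e] := @powR_second_difference alpha _ kR.
  rewrite -lerBrDl.
  have -> : g k.+2 - g k.+1 - (g k.+1 - g k) = X * (sg * (alpha * (alpha - 1) * u `^ (alpha - 2))).
    by rewrite -e /g -[k.+2]addn2 -[k.+1]addn1 !natrD; ring.
  have -> : sg * (alpha * (alpha - 1) * u `^ (alpha - 2)) = `|alpha * (alpha - 1)| * u `^ (alpha - 2).
    by rewrite normrM (gtr0_norm al0) -sgE; ring.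
  rewrite lamE [leLHS](_ : _ = X * (`|alpha * (alpha - 1)| * (N%:R `^ (alpha - 2) * 16^-1))); last by ring.
  rewrite ler_wpM2l ?(ltW X0) // ler_wpM2l ?normr_ge0 //.
  have /andP[h _] := @powR_dyadic_bounds N k u (alpha - 2) N0 Nk (leq_trans (ltnW kL) LN) hu1 hu2.
  apply: le_trans h; rewrite ler_wpM2l ?powR_ge0 //.
  rewrite powRN lef_pV2 ?posrE ?powR_gt0 //.
  rewrite (_ : 16 = 4 `^ 2); last by rewrite (@powR_mulrn _ _ 2) //; ring.
  by apply: ler_powR; rewrite ?ler1n // ler_norml; lra.
- by rewrite mulr_ge0 // divr_ge0 // ?sqr_ge0 // ltW.
move=> k /andP[Nk kL]; have kR : 0 < k%:R :> R by rewrite ltr0n (leq_trans N0).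
have [u /andP[hu1 hu2] e] := @powR_forward_difference alpha _ kR.
have -> : g k.+1 - g k = sg * (X * (alpha * u `^ (alpha - 1))).
  by rewrite -e /g -[k.+1]addn1 natrD; ring.
rewrite normrM sg1 mul1r ger0_norm; last by rewrite !mulr_ge0 ?powR_ge0 // ltW.
have /andP[_ h] := @powR_dyadic_bounds N k u (alpha - 1) N0 Nk (leq_trans kL LN) hu1 ltac:(lra).
have Na1 : N%:R `^ (alpha - 1) = N%:R `^ alpha / N%:R.
  by rewrite powRB ?powRr1 // (gt_eqF NR0) implybT.
(* In the bound for the first differences, 2 dominates [alpha] and 4 dominates [4 ^ |alpha - 1|]. *)
have -> : 8 * (s ^+ 2 / N%:R) = X * (2 * (N%:R `^ (alpha - 1) * 4)).
  by rewrite s2 Na1; ring.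
rewrite ler_wpM2l ?(ltW X0) // ler_pM ?powR_ge0 ?(ltW al0) ?(ltW al2) // (le_trans h) //.
rewrite ler_wpM2l ?powR_ge0 // -[leRHS]powRr1 // ler_powR //; first lra.
by rewrite ler_norml; lra.
Qed.

Lemma power_block_trivial (X : R) (N L : nat) : 0 < X -> (0 < N)%N -> (N <= L <= N * 2)%N ->
  `|\sum_(N <= k < L) sin (k%:R `^ alpha * X)| <= N%:R * (4 * (X * N%:R `^ alpha)).
Proof.
move=> X0 N0 /andP[NL LN]; have [ha0 ha2] := (al0, al2).
have NR0 : 0 < N%:R :> R by rewrite ltr0n.
apply: (@le_trans _ _ ((L - N)%:R * (4 * (X * N%:R `^ alpha)))).
  apply: norm_sum_sin_small => k /andP[Nk kL].
  rewrite ger0_norm ?mulr_ge0 ?powR_ge0 ?(ltW X0) //.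
  rewrite mulrCA [leLHS]mulrC ler_wpM2l ?(ltW X0) //.
  apply: (@le_trans _ _ ((2 * N%:R) `^ alpha)).
    by apply: ge0_ler_powR; rewrite ?nnegrE ?(ltW al0) // -natrM ler_nat; lia.
  rewrite powRM // ler_wpM2r ?powR_ge0 //.
  rewrite (_ : 4 = 2 `^ 2); last by rewrite (@powR_mulrn _ _ 2) //; ring.
  by rewrite ler_powR //; lra.
by rewrite ler_wpM2r ?mulr_ge0 ?powR_ge0 ?(ltW X0) // ler_nat; lia.
Qed.


Lemma uniform_cvg_power_sine (c : nat -> R) (A : set R) :
  (forall k, (0 < k)%N -> 0 <= c k) -> (forall k, (0 < k)%N -> c k.+1 <= c k) ->
  (fun k : nat => c k * k%:R) @ \oo --> (0 : R) -> bounded_set A ->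
  uniformly_convergent_on A (sine_sum c (fun k => k%:R `^ alpha)).
Proof.
move=> c0 cd ck [M [_ hM]]; have [ha0 ha2] := (al0, al2).
pose B := Num.sqrt (`|M| + 1).
(* At [N = 2 ^ i], [s] is [sqrt X * rr ^ i] and [s / N] is [sqrt X * rho ^ i]. From [0 < alpha < 2]
   comes [1 < rr < 2]: the first fits [hump], the second is summable. [B] bounds [sqrt X] on [A]. *)
pose rr := 2 `^ (alpha / 2) : R; pose rho := rr / 2.
(* Expanding the bound of [power_block_le]: [30 / kappa] belongs to [1 / s], [80 / kappa] to
   [s / N], 24 to [(s / N) ^ 2]. The 4 in [P] is from the trivial bound. *)
pose P := 4 + 30 / kappa; pose Q := 80 * B / kappa + 24 * B ^+ 2.
have k0 := kappa_gt0.
have rr1 : 1 < rr by rewrite -[ltLHS](powRr0 2); apply: ltr_powR_base2; lra.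
have rr2 : rr < 2.
  by rewrite -[ltRHS]powRr1 //; apply: ltr_powR_base2; lra.
have rho0 : 0 < rho by rewrite /rho; lra.
have rho1 : rho < 1 by rewrite /rho; lra.
have B0 : 0 <= B by rewrite sqrtr_ge0.
have P0 : 0 <= P by rewrite addr_ge0 // divr_ge0 // ltW.
have Q0 : 0 <= Q by rewrite addr_ge0 ?mulr_ge0 ?invr_ge0 ?sqr_ge0 // ltW.
have geo (q : R) I : 0 <= q -> q < 1 -> \sum_(0 <= i < I) q ^+ i <= 1 / (1 - q).
  move=> q0 q1; rewrite ler_pdivlMr ?subr_gt0 // big_mkord -subr_ge0.
  suff -> : 1 - (\sum_(i < I) q ^+ i) * (1 - q) = q ^+ I by apply: exprn_ge0.
  have := subrX1 q I; lra.
pose C := 4 * P * (rr / (rr - 1)) + Q * (1 / (1 - rho)) + 9 * (1 / (1 - 1 / 2)).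
have C0 : 0 <= C.
  have g1 : 0 <= rr / (rr - 1) by rewrite divr_ge0 //; lra.
  have g2 : 0 <= 1 / (1 - rho) by rewrite divr_ge0 //; lra.
  have g3 : 0 <= 9 * (1 / (1 - 1 / 2)) :> R by rewrite mulr_ge0 // divr_ge0 //; lra.
  by apply: addr_ge0 g3; apply: addr_ge0; apply: mulr_ge0 => //; apply: mulr_ge0.
apply: (@uniform_cvg_sine_sum _ c (fun k => k%:R `^ alpha) A 2 C) => // x Ax.
have xB : `|x| <= `|M| + 1.
  by apply: hM Ax; rewrite (le_lt_trans (ler_norm _)) // ltrDl.
pose X := `|x|; have [X0|X0] := eqVneq X 0.
  exists (fun=> 0); split => // [I|i L _].
    by rewrite big1.
  rewrite big1 ?normr0 ?mulr0 // => k _.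
  by move/eqP: X0; rewrite normr_eq0 => /eqP->; rewrite mulr0 sin0.
have {}X0 : 0 < X by rewrite lt_neqAle eq_sym X0 normr_ge0.
pose s0 := Num.sqrt X; have s00 : 0 < s0 by rewrite sqrtr_gt0.
have s0B : s0 <= B by rewrite ler_wsqrtr.
pose w i := 4 * P * hump (s0 * rr ^+ i) + Q * rho ^+ i + 9 * (1 / 2) ^+ i.
have si0 i : 0 < s0 * rr ^+ i by rewrite mulr_gt0 // exprn_gt0 //; lra.
exists w; split.
- move=> i; apply: addr_ge0; first apply: addr_ge0.
  + by apply: mulr_ge0; [exact: mulr_ge0|exact: hump_ge0 (ltW (si0 i))].
  + by apply: mulr_ge0 => //; rewrite exprn_ge0 // ltW.
  + by apply: mulr_ge0 => //; rewrite exprn_ge0 //; lra.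
- move=> I; rewrite !big_split /= -!mulr_sumr /C; apply: lerD; first apply: lerD.
  + by rewrite ler_wpM2l ?mulr_ge0 // sum_hump_le // ltW.
  + by rewrite ler_wpM2l // geo // ltW.
  + by rewrite ler_wpM2l // geo //; lra.
move=> i L; rewrite expnSr => hL.
have N0 : (0 < 2 ^ i)%N by rewrite expn_gt0.
have NR : 0 < (2 ^ i)%:R :> R by rewrite ltr0n.
rewrite norm_sum_sin_norm -/X.
have Nal : ((2 ^ i)%:R : R) `^ alpha = (rr ^+ i) ^+ 2 by rewrite powR_nat_double.
have sE : Num.sqrt (X * (2 ^ i)%:R `^ alpha) = s0 * rr ^+ i.
  rewrite Nal sqrtrM ?(ltW X0) // sqrtr_sqr ger0_norm // exprn_ge0 //; lra.
have triv := power_block_trivial X0 N0 hL.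
have := power_block_le X0 N0 hL; rewrite /= sE.
have XE : X * (2 ^ i)%:R `^ alpha = (s0 * rr ^+ i) ^+ 2.
  by rewrite Nal exprMn sqr_sqrtr // ltW.
rewrite XE in triv.
set S := `|_| in triv *; set s := s0 * rr ^+ i in triv *.
have sp : 0 < s := si0 i.
have rhoE : rr ^+ i / (2 ^ i)%:R = rho ^+ i by rewrite /rho expr_div_n natrX.
have halfE : 1 / (2 ^ i)%:R = (1 / 2) ^+ i :> R by rewrite expr_div_n expr1n natrX.
have sN : s / (2 ^ i)%:R <= B * rho ^+ i.
  by rewrite /s -mulrA rhoE ler_wpM2r // exprn_ge0 // ltW.
have rhoi : 0 <= rho ^+ i <= 1 by rewrite exprn_ge0 ?exprn_ile1 // ltW.
have sN0 : 0 <= s / (2 ^ i)%:R by rewrite divr_ge0 // ltW.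
have sN2 : (s / (2 ^ i)%:R) ^+ 2 <= B ^+ 2 * rho ^+ i.
  apply: (@le_trans _ _ ((B * rho ^+ i) ^+ 2)).
    by rewrite ler_pXn2r // nnegrE // (le_trans sN0).
  rewrite exprMn ler_wpM2l ?sqr_ge0 // expr2 -[leRHS]mulr1.
  by case/andP: rhoi => *; rewrite ler_wpM2l.
move=> full; rewrite [leRHS]mulrC -ler_pdivrMr //.
rewrite /w -/s -addrA -lerBlDr; apply: le_hump => //; first exact: ltW.
- move=> s1; apply: (@le_trans _ _ (4 * s ^+ 2)).
    rewrite lerBlDr; apply: (@le_trans _ _ (4 * s ^+ 2)).
      by rewrite ler_pdivrMr // mulrC.
    by rewrite lerDl; apply: addr_ge0; apply: mulr_ge0 => //; case/andP: rhoi.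
  apply: (@le_trans _ _ (4 * s)); first by rewrite ler_wpM2l // expr2 ler_piMr // ltW.
  by rewrite ler_wpM2r ?(ltW sp) // lerDl divr_ge0 // ltW.
move=> s1; rewrite lerBlDr.
apply: (@le_trans _ _ ((8 * (s ^+ 2 / (2 ^ i)%:R) + 3) * (10 / (kappa * s) + 3 / (2 ^ i)%:R))).
  by rewrite ler_pdivrMr // mulrC.
have -> : (8 * (s ^+ 2 / (2 ^ i)%:R) + 3) * (10 / (kappa * s) + 3 / (2 ^ i)%:R) =
   80 / kappa * (s / (2 ^ i)%:R) + 24 * (s / (2 ^ i)%:R) ^+ 2 + 30 / kappa / s + 9 * (1 / (2 ^ i)%:R).
  by field; rewrite !gt_eqF.
rewrite halfE addrA lerD2r addrC; apply: lerD; last first.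
  by rewrite ler_wpM2r ?invr_ge0 ?(ltW sp) // lerDr.
have -> : Q * rho ^+ i = 80 / kappa * (B * rho ^+ i) + 24 * (B ^+ 2 * rho ^+ i).
  by rewrite /Q; ring.
apply: lerD; last by rewrite ler_wpM2l.
by rewrite ler_wpM2l // divr_ge0 // ltW.
Qed.

End PowerPhase.
End PowerPhases.

(** * An inverse form of Weyl's inequality *)

(** Pigeonhole on pairs formed by an interval of length [l] and a residue modulo [mu]; [f] codes the
    pair as one number. *)
Lemma collision (H : seq nat) (N l mu : nat) : uniq H -> {in H, forall h, (h < N)%N} ->
  (0 < l)%N -> (0 < mu)%N -> ((N %/ l).+1 * mu < size H)%N ->
  exists h h', [/\ h \in H, h' \in H, (h < h')%N, (mu %| h' - h)%N & (h' - h < l)%N].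
Proof.
move=> uH HN l0 mu0 sH; apply: contrapT => no.
pose f h := (h %/ l * mu + h %% mu)%N.
have inj : {in H &, injective f}.
  suff lt_inj h h' : h \in H -> h' \in H -> (h < h')%N -> f h = f h' -> False.
    move=> h h' hH h'H e; case: (ltngtP h h') => // lt.
      by case: (lt_inj h h' hH h'H lt e).
    by case: (lt_inj h' h h'H hH lt (esym e)).
  move=> hH h'H lt e; apply: no; exists h, h'.
  have e1 : (h %/ l = h' %/ l)%N.
    by have := congr1 (divn^~ mu) e; rewrite /f /= !divnMDl // !(divn_small (ltn_pmod _ mu0)) !addn0.
  have e2 : (h %% mu = h' %% mu)%N.
    by have := congr1 (modn^~ mu) e; rewrite /f /= !modnMDl !modn_mod.
  split => //; first by rewrite -eqn_mod_dvd ?e2 // ltnW.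
  have := divn_eq h l; have := divn_eq h' l; rewrite e1.
  by have := ltn_pmod h' l0; lia.
suff : (size H <= (N %/ l).+1 * mu)%N by rewrite leqNgt sH.
rewrite -(size_map f) -(size_iota 0 ((N %/ l).+1 * mu)).
apply: uniq_leq_size; first by rewrite map_inj_in_uniq.
move=> _ /mapP[h hH ->]; rewrite mem_iota /= add0n /f mulSn addnC -addSn.
by apply: leq_add; rewrite ?ltn_pmod // leq_mul2r leq_div2r ?orbT // ltnW // HN.
Qed.

Lemma pigeonhole_filter (H : seq nat) (Y : nat) (P : nat -> pred nat) : (0 < Y)%N ->
  {in H, forall h, exists2 q, (0 < q <= Y)%N & P q h} ->
  exists2 q, (0 < q <= Y)%N & (size H <= size [seq h <- H | P q h] * Y)%N.
Proof.
move=> Y0 hP; apply: contrapT => no.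
have small q : (0 < q <= Y)%N -> (count (P q) H * Y < size H)%N.
  by move=> hq; rewrite ltnNge -size_filter; apply/negP => h; apply: no; exists q.
have H0 : (0 < size H)%N by apply: leq_ltn_trans (small 1%N _); rewrite ?Y0.
have : (size H <= \sum_(1 <= q < Y.+1) count (P q) H)%N.
  under eq_bigr do rewrite -sum1_count big_mkcond /=.
  rewrite exchange_big /= -sum1_size big_seq [leqRHS]big_seq.
  apply: leq_sum => h /hP [q hq Pq].
  rewrite (bigD1_seq q) ?iota_uniq ?mem_index_iota //= Pq; lia.
rewrite -(leq_pmul2l Y0) big_distrr /= leqNgt => /negP; apply.
apply: (@leq_ltn_trans (\sum_(1 <= q < Y.+1) (size H).-1)%N).
  rewrite big_nat [leqRHS]big_nat; apply: leq_sum => q hq.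
  by rewrite mulnC; have := small q hq; lia.
by rewrite sum_nat_const_nat; nia.
Qed.

Lemma exists_fraction (T K : nat) : (0 < T)%N -> (2 * T < K)%N ->
  exists m, [/\ (0 < m)%N, (2 * T * m < K)%N & (K <= 4 * T * m)%N].
Proof.
move=> T0 TK; exists (K.-1 %/ (2 * T))%N.
have T20 : (0 < 2 * T)%N by rewrite muln_gt0.
have := divn_eq K.-1 (2 * T); have := ltn_pmod K.-1 T20.
have : (0 < K.-1 %/ (2 * T))%N by rewrite divn_gt0 //; lia.
move: (K.-1 %/ _)%N (K.-1 %% _)%N => m r m0 rT e; split => //; nia.
Qed.

(** * Rational approximation from a dense set of returns *)

Section Recurrence.
Context {R : realType}.

Lemma int_small_eq0 (a : int) : `|a%:~R| < 1 :> R -> a = 0.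
Proof.
rewrite -intr_norm (_ : 1 = 1%:~R) // ltr_int; lia.
Qed.

(** Two close elements of [H] give [q] with error [th] at most [2 / W]. Further collisions, forced
    to differ by a multiple of [q * m] with [m] about [K / (2 * T)], give [l * q] with [m <= l < K];
    as [l * th] does not wrap around, it is itself at most [2 / W]. *)
Lemma dense_recurrence (beta W : R) (H : seq nat) (N T : nat) :
  uniq H -> {in H, forall h, (h < N)%N} -> (0 < T)%N -> (8 * T ^ 2 <= N)%N ->
  (N <= size H * T)%N -> 20 * T%:R <= W ->
  {in H, forall h, exists a : int, `|h%:R * beta - a%:~R| * W <= 1} ->
  exists (q : nat) (a : int), (0 < q <= 2 * T)%N /\
    `|q%:R * beta - a%:~R| * (W * N%:R) <= 32 * T%:R ^+ 2.
Proof.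
move=> uH HN T0 TN HT WT hH.
have T1 : 1 <= T%:R :> R by rewrite ler1n.
have W0 : 0 < W by lra.
have diff h h' : h \in H -> h' \in H -> (h < h')%N ->
    exists a : int, `|(h' - h)%:R * beta - a%:~R| <= 2 / W.
  move=> hh hh' lt; have [a ha] := hH h hh; have [a' ha'] := hH h' hh'.
  exists (a' - a); rewrite natrB ?(ltnW lt) // intrB ler_pdivlMr //.
  rewrite (_ : _ - _ = (h'%:R * beta - a'%:~R) - (h%:R * beta - a%:~R)); last by ring.
  apply: le_trans (ler_wpM2r (ltW W0) (ler_normB _ _)) _.
  by rewrite mulrDl; lra.
have [h [h' [hh hh' lt _ small]]] : exists h h', [/\ h \in H, h' \in H, (h < h')%N,
    (1 %| h' - h)%N & (h' - h < 2 * T)%N].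
  apply: (@collision H N) => //; first by rewrite muln_gt0.
  rewrite muln1; have := leq_trunc_div N (2 * T); nia.
have [a ha] := diff h h' hh hh' lt.
pose q := (h' - h)%N; have q0 : (0 < q)%N by rewrite subn_gt0.
have q2 : (q <= 2 * T)%N by apply: ltnW.
set th := _ - _ in ha.
exists q, a; split; first by rewrite q0.
rewrite -/th.
(* The bound [2 K |th| <= 1] improves itself, so that K may grow up to N / q. *)
have scale K : (2 * T < K)%N -> (q * K <= N)%N -> 2 * K%:R * `|th| <= 1 ->
    K%:R * `|th| <= 8 * T%:R / W.
  move=> TK qK Kth.
  have K0 : (0 < K)%N := leq_ltn_trans (leq0n _) TK.
  have [m [m0 mK Km]] := exists_fraction T0 TK.
  have [u [u' [hu hu' ltu dvd du]]] : exists u u', [/\ u \in H, u' \in H, (u < u')%N,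
      (q * m %| u' - u)%N & (u' - u < q * K)%N].
    apply: (@collision H N) => //; rewrite ?muln_gt0 ?q0 ?K0 //.
    (* After multiplication by [K * T], the pigeonhole condition follows from [2 * T * m < K] and
       the density of [H]. *)
    rewrite -(ltn_pmul2r K0).
    have : ((N %/ (q * K)) * (q * K) <= N)%N by apply: leq_trunc_div.
    move: (N %/ (q * K))%N => v hv.
    apply: (@leq_ltn_trans (2 * N * m)%N).
      have -> : (v.+1 * (q * m) * K = (v * (q * K) + q * K) * m)%N by rewrite mulSn; ring.
      by rewrite leq_mul2r mul2n -addnn leq_add ?orbT.
    rewrite -(ltn_pmul2r T0); apply: (@leq_trans (N * K)%N).
      have -> : (2 * N * m * T = N * (2 * T * m))%N by ring.
      by rewrite ltn_pmul2l // (leq_trans _ TN) // muln_gt0 expn_gt0 T0.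
    have -> : (size H * K * T = size H * T * K)%N by ring.
    by rewrite leq_mul2r HT orbT.
  have [b hb] := diff u u' hu hu' ltu.
  have /dvdnP[s us] := dvd.
  have s0 : (0 < s)%N by case: s us ltu => // us; rewrite -subn_gt0 us mul0n.
  pose l := (s * m)%N.
  have ul : (u' - u)%N = (l * q)%N by rewrite us /l; ring.
  have lK : (l < K)%N.
    by move: du; rewrite ul mulnC ltn_pmul2l.
  have ml : (m <= l)%N by rewrite leq_pmull.
  have eqth : (u' - u)%:R * beta - b%:~R = l%:R * th - (b - l%:Z * a)%:~R.
    by rewrite ul natrM intrB intrM -pmulrn /th -/q; ring.
  have W2 : 2 / W <= 1 / 10 by rewrite ler_pdivrMr //; lra.
  have lth : `|l%:R * th| <= 1 / 2.
    rewrite normrM normr_nat; apply: (@le_trans _ _ (K%:R * `|th|)); last by lra.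
    by rewrite ler_wpM2r // ler_nat ltnW.
  rewrite eqth in hb.
  (* No wrap-around: [l * th] is at most 1/2 and within 1/10 of this integer. *)
  have b0 : b - l%:Z * a = 0.
    apply: int_small_eq0; move: hb lth; rewrite !ler_norml ltr_norml; lra.
  rewrite b0 subr0 in hb.
  have : m%:R * `|th| <= 2 / W.
    apply: le_trans hb; rewrite normrM normr_nat ler_wpM2r // ler_nat //.
  have : K%:R * `|th| <= 4 * T%:R * (m%:R * `|th|).
    by rewrite mulrA ler_wpM2r // -!natrM ler_nat.
  move=> h1 h2; apply: le_trans h1 _.
  rewrite [leRHS](_ : _ = 4 * T%:R * (2 / W)); last by field; rewrite gt_eqF.
  by rewrite ler_wpM2l //; lra.
have TW : T%:R / W <= 1 / 20 by rewrite ler_pdivrMr //; lra.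
have W1 : 1 / W <= T%:R / W by rewrite ler_wpM2r // invr_ge0 ltW.
have all_small j : (q * (2 * T + j.+1) <= N)%N -> 2 * (2 * T + j.+1)%:R * `|th| <= 1.
  elim: j => [|j IH] hj.
    apply: (@le_trans _ _ (2 * (2 * T + 1)%:R * (2 / W))); first by rewrite ler_wpM2l.
    by rewrite natrD natrM; lra.
  have hj' : (q * (2 * T + j.+1) <= N)%N.
    by apply: leq_trans hj; rewrite leq_mul2l leq_add2l leqnSn orbT.
  have := scale (2 * T + j.+1)%N _ hj' (IH hj'); rewrite -[X in (X < _)%N]addn0 ltn_add2l => /(_ isT).
  (* Origin of the 20: raising [K] by one adds [2 * |th| <= 4 / W] to at most [16 * T / W], and
     [16 * T + 4 <= 20 * T <= W]. *)
  rewrite [(2 * T + j.+2)%N]addnS -natr1; lra.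
pose K := (N %/ q)%N.
have KT : (4 * T <= K)%N by rewrite leq_divRL //; nia.
have qK : (q * K <= N)%N by rewrite mulnC leq_trunc_div.
have Nq : (N <= 2 * q * K)%N.
  by have := divn_eq N q; have := ltn_pmod N q0; rewrite -/K; nia.
have hK : K%:R * `|th| <= 8 * T%:R / W.
  apply: scale => //; first by rewrite (leq_trans _ KT) // ltn_pmul2r.
  have TK : (2 * T < K)%N by rewrite (leq_trans _ KT) // ltn_pmul2r.
  have KE : K = (2 * T + (K - 2 * T).-1.+1)%N by rewrite prednK ?subn_gt0 // subnKC // ltnW.
  by rewrite KE; apply: all_small; rewrite -KE.
(* The 32 is 4 times 8: [N <= 2 * q * K <= 4 * T * K], and [K * |th| <= 8 * T / W]. *)
have : N%:R * `|th| <= 32 * T%:R ^+ 2 / W.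
  apply: (@le_trans _ _ ((4 * T)%:R * (K%:R * `|th|))).
    rewrite mulrA ler_wpM2r // -natrM ler_nat.
    by apply: leq_trans Nq _; by rewrite (_ : (4 * T = 2 * (2 * T))%N) ?leq_mul // mulnA.
  rewrite [leRHS](_ : _ = (4 * T)%:R * (8 * T%:R / W)); last by rewrite natrM; field; rewrite gt_eqF.
  by rewrite ler_wpM2l.
by rewrite ler_pdivlMr // => h3; apply: le_trans h3; rewrite le_eqVlt; apply/orP; left; apply/eqP; ring.
Qed.

End Recurrence.

(** * Finite differences of polynomials *)

Section Difference.
Context {S : comNzRingType}.

Definition poly_diff (h : S) (p : {poly S}) := (p \Po ('X + h%:P)) - p.

Lemma horner_poly_diff h p x : (poly_diff h p).[x] = p.[x + h] - p.[x].
Proof. by rewrite /poly_diff hornerD hornerN horner_comp hornerD hornerX hornerC. Qed.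

Lemma poly_diff_size_coef h (d : nat) (p : {poly S}) : (size p <= d.+1)%N ->
  (size (poly_diff h p) <= d)%N /\ (poly_diff h p)`_d.-1 = d%:R * h * p`_d.
Proof.
elim: d p => [|d IH] p sp.
  by rewrite (size1_polyC sp) /poly_diff comp_polyC subrr size_poly0 coef0 !mul0r.
elim/poly_ind: p sp => [|q c _] sp.
  have -> : poly_diff h 0 = 0 by rewrite /poly_diff -polyC0 comp_polyC subrr.
  by rewrite !coef0 mulr0 size_poly0.
have sq : (size q <= d.+1)%N.
  have [->|q0] := eqVneq q 0; first by rewrite size_poly0.
  by move: sp; rewrite size_MXaddC (negbTE q0) ltnS.
have [IH1 IH2] := IH q sq.
(* The product rule for [q * 'X + c]: the two top coefficients from [q] add up to the factor
   [d.+1]. *)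
have E : poly_diff h (q * 'X + c%:P) = poly_diff h q * 'X + h *: poly_diff h q + h *: q.
  rewrite /poly_diff !(comp_polyD, comp_polyM, comp_polyX, comp_polyC) -!mul_polyC.
  by ring.
split.
  rewrite E; apply: leq_trans (size_polyD _ _) _; rewrite geq_max; apply/andP; split; last first.
    exact: leq_trans (size_scale_leq _ _) sq.
  apply: leq_trans (size_polyD _ _) _; rewrite geq_max; apply/andP; split.
    apply: leq_trans (size_polyMleq _ _) _; rewrite size_polyX addn2 /=; exact: IH1.
  by apply: leq_trans (size_scale_leq _ _) _; apply: leqW.
rewrite E !coefD !coefZ coefMX coefMX coefC /= addr0 [(poly_diff h q)`_d]nth_default // mulr0 addr0.
case: d IH1 IH2 {IH sq sp E} => [|d] IH1 IH2 /=; first by rewrite add0r mul1r.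
by rewrite -[in LHS]/(d.+1.-1) IH2 -[in RHS]natr1 !mulrDl !mul1r.
Qed.
End Difference.

(** * Weyl differencing and its inversion *)

Section WeylInverse.
Context {R : realType}.

(** Adding the square of the sine sum gives the squared modulus of the exponential sum, for which
    this is an identity. *)
Lemma weyl_differencing (g : nat -> R) L :
  (\sum_(0 <= n < L) cos (g n)) ^+ 2 <=
  L%:R + 2 * \sum_(1 <= h < L) `|\sum_(0 <= n < L - h) cos (g (n + h)%N - g n)|.
Proof.
suff E : (\sum_(0 <= n < L) cos (g n)) ^+ 2 + (\sum_(0 <= n < L) sin (g n)) ^+ 2 =
  L%:R + 2 * \sum_(1 <= h < L) \sum_(0 <= n < L - h) cos (g (n + h)%N - g n).
  apply: (@le_trans _ _ (L%:R + 2 * \sum_(1 <= h < L) \sum_(0 <= n < L - h) cos (g (n + h)%N - g n))).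
    by rewrite -E lerDl sqr_ge0.
  by rewrite lerD2l ler_wpM2l //; apply: ler_sum => h _; exact: ler_norm.
elim: L => [|L IH]; first by rewrite !big_geq // expr0n mulr0 !addr0.
(* The new index [L] contributes one term to each shift: the pair [(L - h, L)]. *)
have -> : \sum_(1 <= h < L.+1) \sum_(0 <= n < L.+1 - h) cos (g (n + h)%N - g n) =
   \sum_(1 <= h < L) \sum_(0 <= n < L - h) cos (g (n + h)%N - g n) +
   \sum_(0 <= n < L) cos (g L - g n).
  have -> : \sum_(1 <= h < L) \sum_(0 <= n < L - h) cos (g (n + h)%N - g n) =
      \sum_(1 <= h < L.+1) \sum_(0 <= n < L - h) cos (g (n + h)%N - g n).
    case: L {IH} => [|L]; first by rewrite !big_geq.
    by rewrite [RHS]big_nat_recr //= subnn [X in _ = _ + X]big_geq ?addr0.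
  have -> : \sum_(0 <= n < L) cos (g L - g n) = \sum_(1 <= h < L.+1) cos (g L - g (L - h)%N).
    by rewrite big_add1 /= [LHS]big_nat_rev; apply: eq_bigr => i _; rewrite add0n.
  rewrite -big_split /=; apply: eq_big_nat => h /andP[h1 hL].
  by rewrite subSn // big_nat_recr //= subnK.
rewrite -[L.+1%:R]natr1 !(big_nat_recr L) //=.
set C := \sum_(0 <= n < L) cos (g n) in IH *; set S := \sum_(0 <= n < L) sin _ in IH *.
have -> : \sum_(0 <= n < L) cos (g L - g n) = cos (g L) * C + sin (g L) * S.
  by rewrite !mulr_sumr -big_split /=; apply: eq_bigr => n _; rewrite cosB.
have := cos2Dsin2 (g L); move: IH; rewrite mulrDr.
move: (\sum_(1 <= h < L) _) => Z; rewrite !expr2; nra.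
Qed.

(* T is the saving over the trivial bound that the sum fails to achieve. *)
Definition weyl_inverse (d A : nat) := forall (N L T : nat) (p : {poly R}),
  (2 <= T)%N -> (L <= N)%N -> (size p <= d.+1)%N ->
  N%:R < T%:R * `|\sum_(0 <= n < L) cos (2 * pi * p.[n%:R])| ->
  exists (q : nat) (a : int), (0 < q <= T ^ A)%N /\
    `|q%:R * p`_d - a%:~R| * N%:R ^+ d <= T%:R ^+ A.

Lemma linear_cos_sum_le (b th : R) L : th != 0 -> `|th| <= 1 / 2 ->
  `|\sum_(0 <= n < L) cos (2 * pi * (b + th * n%:R))| <= 3 / `|th|.
Proof.
wlog th0 : b th / 0 < th.
  move=> hw n0 h; have [lt|] := ltP 0 th; first exact: hw.
  rewrite le_eqVlt (negbTE n0) /= => gt0.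
  have := hw (- b) (- th); rewrite oppr_gt0 oppr_eq0 normrN => /(_ gt0 n0 h).
  move=> h'; apply: le_trans h'; rewrite le_eqVlt; apply/orP; left; apply/eqP.
  congr `|_|; apply: eq_bigr => n _.
  by rewrite -cosN; congr cos; ring.
move=> _; rewrite gtr0_norm // => th1.
have p2 := pi_ge2 R.
have x0 : 0 < 2 * pi * th by rewrite mulr_gt0 //; lra.
apply: (@le_trans _ _ (1 + 8 / (2 * pi * th))).
  under eq_bigr do rewrite -sinDpihalf.
  apply: kuzmin_landau => // k; rewrite -!natr1; first by move=> _; nra.
  by move=> _ _; lra.
have : 8 / (2 * pi * th) <= 2 / th.
  rewrite (_ : 2 / th = 8 / (4 * th)); last by field; rewrite gt_eqF.
  by rewrite ler_wpM2l // lef_pV2 ?posrE ?mulr_gt0 //; nra.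
have : 1 <= 1 / th by rewrite ler_pdivlMr //; lra.
by rewrite -[2 / th]mulrC -[3 / th]mulrC -[1 / th]mulrC; lra.
Qed.

Lemma weyl_inverse1 : weyl_inverse 1 3.
Proof.
move=> N L T p T2 LN sp hS.
have T2R : 2 <= T%:R :> R by rewrite ler_nat.
have [a ha] := nearest_int p`_1.
exists 1%N, a; rewrite expn_gt0 (leq_trans _ T2) //=; split => //.
rewrite mul1r expr1; set th := _ - _ in ha *.
have [->|th0] := eqVneq th 0; first by rewrite normr0 mul0r exprn_ge0.
have := linear_cos_sum_le p`_0 L th0 ha.
have -> : \sum_(0 <= n < L) cos (2 * pi * (p`_0 + th * n%:R)) =
    \sum_(0 <= n < L) cos (2 * pi * p.[n%:R]).
  apply: eq_bigr => n _; rewrite (horner_coef_wide _ sp) !big_ord_recl big_ord0 /= addr0.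
  rewrite -[RHS](cos_intpi2 (- (a * n%:Z))); congr cos.
  by rewrite /th mulrNz intrM -pmulrn expr0 expr1 /bump /=; ring.
have t0 : 0 < `|th| by rewrite normr_gt0.
move=> h; have : N%:R < T%:R * (3 / `|th|).
  by apply: lt_le_trans hS _; rewrite ler_wpM2l.
rewrite mulrA ltr_pdivlMr // => h2.
rewrite mulrC; apply: le_trans (ltW h2) _.
(* Exponent 3 absorbs the constant: [3 * T <= T ^ 3] for [T >= 2]. *)
rewrite exprS ler_wpM2l // expr2; nra.
Qed.

End WeylInverse.

Section WeylStep.
Context {R : realType}.

Lemma norm_sum_cos_le (g : nat -> R) n : `|\sum_(0 <= k < n) cos (g k)| <= n%:R.
Proof.
apply: le_trans (ler_norm_sum _ _ _) _.
rewrite -[n in leRHS]subn0 -[(n - 0)%N]muln1 -sum_nat_const_nat natr_sum.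
by apply: ler_sum => k _; exact: cos_max.
Qed.

(** Shifts with small correlation account for at most a quarter of the squared sum's lower bound,
    and [4 * T ^ 2 <= N] does the same for the diagonal, so at least a proportion [1 / (8 * T ^ 2)]
    of the shifts is large. *)
Lemma many_large_differences (g : nat -> R) (N L T : nat) :
  (0 < T)%N -> (L <= N)%N -> (4 * T ^ 2 <= N)%N ->
  N%:R < T%:R * `|\sum_(0 <= n < L) cos (g n)| ->
  (N <= size [seq h <- iota 1 L.-1 |
     (N%:R < (8 * T ^ 2)%:R * `|\sum_(0 <= n < L - h) cos (g (n + h)%N - g n)|)%R ]
    * (8 * T ^ 2))%N.
Proof.
move=> T0 LN TN hS; set D := fun h => `|\sum_(0 <= n < L - h) cos (g (n + h)%N - g n)|.
set H := [seq _ <- _ | _].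
have N0 : (0 < N)%N by apply: leq_trans TN; rewrite muln_gt0 expn_gt0 T0.
have NR : 0 < N%:R :> R by rewrite ltr0n.
have TR : 1 <= T%:R :> R by rewrite ler1n.
have T2R : 1 <= T%:R ^+ 2 :> R by rewrite exprn_ege1.
have TNR : 4 * T%:R ^+ 2 <= N%:R :> R by rewrite -natrX -natrM ler_nat.
have T8 : (8 * T ^ 2)%:R = 8 * T%:R ^+ 2 :> R by rewrite natrM natrX.
have sumD : \sum_(1 <= h < L) D h <= (size H)%:R * N%:R + N%:R * (N%:R / (8 * T%:R ^+ 2)).
  rewrite /index_iota subn1 (bigID (fun h => N%:R < (8 * T ^ 2)%:R * D h)) /=.
  apply: lerD.
    rewrite -big_filter -sum1_size natr_sum mulr_suml; apply: ler_sum => h _.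
    rewrite mul1r; apply: le_trans (norm_sum_cos_le _ _) _.
    by rewrite ler_nat (leq_trans (leq_subr _ _)).
  apply: (@le_trans _ _ (\sum_(h <- iota 1 L.-1 | ~~ (N%:R < (8 * T ^ 2)%:R * D h)) (N%:R / (8 * T%:R ^+ 2)))).
    apply: ler_sum => h; rewrite -leNgt T8 => hh.
    by rewrite ler_pdivlMr 1?mulrC // mulr_gt0 //; lra.
  apply: (@le_trans _ _ (\sum_(h <- iota 1 L.-1) (N%:R / (8 * T%:R ^+ 2)))).
    rewrite [leLHS]big_mkcond; apply: ler_sum => h _; case: ifP => // _.
  rewrite big_const_seq count_predT size_iota iter_addr_0 -[leLHS]mulr_natl ler_wpM2r //.
  by rewrite ler_nat (leq_trans (leq_pred _)).
have W := weyl_differencing g L.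
set S := \sum_(_ <= _ < _) cos _ in hS W.
have S2 : N%:R ^+ 2 < T%:R ^+ 2 * S ^+ 2.
  rewrite -exprMn -[ltRHS]ger0_norm ?sqr_ge0 // normrX normrM [`|T%:R|]normr_nat.
  by rewrite ltrXn2r // ltW.
have key : N%:R ^+ 2 < (T%:R : R) ^+ 2 * (N%:R + 2 * ((size H)%:R * N%:R + N%:R * (N%:R / (8 * T%:R ^+ 2)))).
  apply: lt_le_trans S2 _; rewrite ler_wpM2l //.
  apply: le_trans W _; apply: lerD; first by rewrite ler_nat.
  by rewrite ler_wpM2l.
have E : T%:R ^+ 2 * (N%:R + 2 * ((size H)%:R * N%:R + N%:R * (N%:R / (8 * T%:R ^+ 2)))) =
   N%:R * (T%:R ^+ 2 + 2 * T%:R ^+ 2 * (size H)%:R + N%:R / 4) :> R.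
  by field; rewrite gt_eqF //; lra.
rewrite E expr2 ltr_pM2l // in key.
rewrite -(ler_nat R) natrM T8; lra.
Qed.

(** As [T >= 2], constants become powers: [20 <= T ^ 5], [d.+1 <= T ^ d.+1],
    [8 * T ^ 2 <= T ^ 5]. *)
Lemma weyl_inverse_constant_le (T A d : nat) : (2 <= T)%N ->
  ((20 * d.+1 * ((8 * T ^ 2) ^ A.+1) ^ 2) ^ d.+2 <= T ^ ((6 + d + 10 * A.+1) * d.+2))%N.
Proof.
move=> T2; rewrite expnM; rewrite leq_exp2r //.
have p2 m : (2 ^ m <= T ^ m)%N by case: m => // m; rewrite leq_exp2r.
have -> : (6 + d + 10 * A.+1 = (5 + d.+1) + 5 * A.+1 * 2)%N by ring.
rewrite !expnD; apply: leq_mul.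
  apply: leq_mul; first by apply: leq_trans (p2 5%N).
  by apply: leq_trans (p2 d.+1); apply: ltnW; apply: ltn_expl.
rewrite expnM; rewrite leq_exp2r //; rewrite expnM; rewrite leq_exp2r //.
rewrite (_ : 5 = 3 + 2)%N // expnD leq_mul2r; apply/orP; right; exact: (p2 3%N).
Qed.

(** For many shifts [h] the difference has degree [d] and leading coefficient [d.+1 * h * p_(d+1)],
    to which induction applies. A pigeonhole makes the denominator [q] common to a dense set of [h],
    and [dense_recurrence] then eliminates [h]. *)
Lemma weyl_inverseS d A : (0 < d)%N -> weyl_inverse (R := R) d A ->
  weyl_inverse (R := R) d.+1 ((6 + d + 10 * A.+1) * d.+2).
Proof.
move=> d0 IH N L T p T2 LN sp hS.
have hZ := weyl_inverse_constant_le A d T2; rewrite -[T%:R ^+ _]natrX.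
set Z := (T ^ (_ * d.+2))%N in hZ *.
(* [T1] is the loss of differencing, [Y] the denominator bound from induction, and [1 / T2'] the
   density left after fixing the denominator. *)
set T1 := (8 * T ^ 2)%N in hZ; pose Y := (T1 ^ A)%N; pose T2' := (T1 ^ A.+1)%N.
have T0 : (0 < T)%N by apply: leq_trans T2.
have T10 : (8 <= T1)%N by rewrite leq_pmulr // expn_gt0 T0.
have Y0 : (0 < Y)%N by rewrite expn_gt0 (leq_trans _ T10).
have T2'E : T2' = (T1 * Y)%N by rewrite /T2' expnS.
have T2'0 : (8 <= T2')%N by rewrite T2'E (leq_trans T10) // leq_pmulr.
have YT2 : (Y <= T2')%N by rewrite T2'E leq_pmull // (leq_trans _ T10).
have Z1 : ((20 * T2' ^ 2) ^ d.+2 <= Z)%N.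
  apply: leq_trans hZ; rewrite leq_exp2r //; rewrite -/T2' leq_mul2r.
  by apply/orP; right; rewrite leq_pmulr.
have Z0 : (0 < Z)%N by apply: leq_trans Z1; rewrite expn_gt0 muln_gt0 expn_gt0 (leq_trans _ T2'0).
(* For small [N] nothing is needed from the sum: denominator 1 works, since [N ^ d.+1 <= Z]. *)
have [small|large] := ltnP N (20 * T2' ^ 2).
  have [a ha] := nearest_int p`_d.+1.
  exists 1%N, a; split; first by rewrite Z0.
  rewrite mul1r; apply: (@le_trans _ _ (1 * N%:R ^+ d.+1)).
    by rewrite ler_wpM2r ?exprn_ge0 //; lra.
  rewrite mul1r -natrX ler_nat; apply: leq_trans Z1.
  apply: (@leq_trans ((20 * T2' ^ 2) ^ d.+1)).
    by rewrite leq_exp2r //; apply: ltnW.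
  by apply: leq_pexp2l => //; rewrite muln_gt0 expn_gt0 (leq_trans _ T2'0).
have T1T2 : (T1 <= T2')%N by rewrite T2'E leq_pmulr.
have N8 : (8 * T2' ^ 2 <= N)%N by apply: leq_trans large; rewrite leq_mul2r orbT.
have N0 : (0 < N)%N by apply: leq_trans N8; rewrite muln_gt0 expn_gt0 (leq_trans _ T2'0).
have N4 : (4 * T ^ 2 <= N)%N.
  apply: leq_trans N8; apply: (@leq_trans T1); first by rewrite leq_mul2r orbT.
  apply: leq_trans T1T2 _; rewrite expnS expn1 mulnA leq_pmull // muln_gt0 /=.
  exact: leq_trans T2'0.
have := many_large_differences T0 LN N4 hS.
set H := [seq _ <- _ | _]; rewrite -/T1 => HN.
pose P q h := `[< exists a : int,
  `|q%:R * (d.+1%:R * h%:R * p`_d.+1) - a%:~R| * N%:R ^+ d <= Y%:R >].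
have hP : {in H, forall h, exists2 q, (0 < q <= Y)%N & P q h}.
  move=> h; rewrite mem_filter mem_iota => /andP[hh _].
  have [sd cd] := poly_diff_size_coef h%:R sp.
  have [||q [a [hq ha]]] := IH N (L - h)%N T1 (poly_diff h%:R p) _ (leq_trans (leq_subr _ _) LN) sd.
  - exact: leq_trans T10.
  - apply: lt_le_trans hh _; rewrite ler_wpM2l // le_eqVlt; apply/orP; left; apply/eqP.
    congr `|_|; apply: eq_bigr => n _.
    by rewrite horner_poly_diff natrD mulrBr.
  exists q => //; apply/asboolP; exists a; move: ha; rewrite cd natrX; exact.
have [q /andP[q0 qY] hq] := pigeonhole_filter Y0 hP.
set Hq := [seq _ <- _ | _] in hq.
have uH : uniq Hq by rewrite !filter_uniq ?iota_uniq.
have HqN : {in Hq, forall h, (h < N)%N}.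
  move=> h; rewrite !mem_filter mem_iota => /and3P[_ _ /andP[h1 h2]].
  apply: leq_trans LN; move: h2; rewrite add1n ltnS => h2.
  by apply: (@leq_ltn_trans L.-1) => //; rewrite ltn_predL; case: (L) h1 h2 => //; case: h {hP}.
have sz : (N <= size Hq * T2')%N.
  apply: leq_trans HN _; rewrite T2'E [(T1 * Y)%N]mulnC mulnA leq_mul2r hq orbT //.
have YR : 0 < Y%:R :> R by rewrite ltr0n.
have WT : 20 * T2'%:R <= N%:R ^+ d / Y%:R :> R.
  rewrite ler_pdivlMr // -natrX -!natrM ler_nat.
  apply: (@leq_trans N); last by rewrite -[leqLHS]expn1 leq_pexp2l.
  by apply: leq_trans large; rewrite -mulnA leq_mul2l expnS expn1 leq_mul2l YT2 orbT.
have T2'pos : (0 < T2')%N by apply: leq_trans T2'0.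
have T2'sq : (0 < T2' ^ 2)%N by rewrite expn_gt0 T2'pos.
have [|r [a [/andP[r0 rT] ha]]] := @dense_recurrence R (q%:R * (d.+1%:R * p`_d.+1)) (N%:R ^+ d / Y%:R) Hq N T2'
   uH HqN T2'pos N8 sz WT.
  move=> h; rewrite mem_filter => /andP[/asboolP[a ha] _]; exists a.
  rewrite [leLHS]mulrA ler_pdivrMr // mul1r; apply: le_trans ha.
  by rewrite le_eqVlt; apply/orP; left; apply/eqP; congr (`|_ - _| * _); ring.
exists (r * (q * d.+1))%N, a; split.
  rewrite !muln_gt0 r0 q0 /=; apply: leq_trans hZ.
  apply: (@leq_trans ((20 * d.+1 * T2' ^ 2) ^ 1)); last first.
    by apply: leq_pexp2l => //; rewrite muln_gt0 T2'sq.
  rewrite expn1; apply: (@leq_trans ((2 * T2') * (T2' * d.+1))%N).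
    by apply: leq_mul => //; rewrite leq_mul2r (leq_trans qY) ?orbT.
  have -> : (2 * T2' * (T2' * d.+1) = 2 * d.+1 * T2' ^ 2)%N by rewrite expnS expn1; ring.
  by rewrite !leq_mul2r orbT.
have -> : (r * (q * d.+1))%:R * p`_d.+1 - a%:~R = r%:R * (q%:R * (d.+1%:R * p`_d.+1)) - a%:~R.
  by rewrite !natrM; ring.
set x := `|_| in ha *.
have : x * N%:R ^+ d.+1 <= 32 * T2'%:R ^+ 2 * Y%:R.
  rewrite -ler_pdivrMr //; apply: le_trans ha.
  by rewrite exprSr le_eqVlt; apply/orP; left; apply/eqP; ring.
move=> h; apply: le_trans h _; rewrite -natrX -!natrM ler_nat.
apply: leq_trans Z1; apply: (@leq_trans ((20 * T2' ^ 2) ^ 3)); last first.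
  apply: leq_pexp2l; last by rewrite !ltnS.
  by rewrite muln_gt0 T2'sq.
rewrite expnMn; apply: (@leq_trans (20 ^ 3 * T2' ^ 3)%N).
  rewrite -mulnA; apply: leq_mul => //; rewrite [(T2' ^ 3)%N]expnSr; exact: leq_mul.
by rewrite leq_mul2l -expnM; apply/orP; right; apply: leq_pexp2l.
Qed.

Lemma exists_weyl_inverse d : exists A, weyl_inverse (R := R) d.+1 A.
Proof.
elim: d => [|d [A IH]]; first by exists 3%N; exact: weyl_inverse1.
by eexists; apply: weyl_inverseS IH.
Qed.

End WeylStep.

(** * Odd integer polynomials near rational points *)

Lemma horner_int_sub_dvd (F : {poly int}) (x y : int) :
  exists m : int, F.[x] - F.[y] = m * (x - y).
Proof.
have /factor_theorem[q hq] : root (F - F.[y]%:P) y.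
  by rewrite /root hornerD hornerN hornerC subrr.
exists q.[x]; have := congr1 (fun p => p.[x]) hq.
by rewrite hornerD hornerN hornerC hornerM hornerXsubC.
Qed.

Lemma horner_odd (S : comNzRingType) (F : {poly S}) (x : S) :
  (forall j, ~~ odd j -> F`_j = 0) -> F.[- x] = - F.[x].
Proof.
move=> hF; rewrite !horner_coef -sumrN; apply: eq_bigr => j _.
have [oj|ej] := boolP (odd j); last by rewrite hF // !mul0r oppr0.
by rewrite exprNn -signr_odd oj expr1 mulN1r mulrN.
Qed.

(** * Complete sums modulo q *)

Section CompleteSums.
Context {R : realType}.

Lemma sum_periodic (f : nat -> R) (q u : nat) : (forall k, f (k + q)%N = f k) ->
  \sum_(u <= k < u + q) f k = \sum_(0 <= k < q) f k.
Proof.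
move=> per; elim: u => [|u IH]; first by rewrite add0n.
case: q per IH => [|q] per IH; first by rewrite addn0 !big_geq.
rewrite -IH addSn big_nat_recr ?leq_addr //=; last by rewrite addnS ltnS leq_addr.
rewrite [in RHS]big_ltn; last by rewrite addnS ltnS leq_addr.
by rewrite per addrC.
Qed.

Lemma sin_lipschitz (x y : R) : `|sin x - sin y| <= `|x - y|.
Proof.
have -> : sin x - sin y = 2 * (sin ((x - y) / 2) * cos ((x + y) / 2)).
  rewrite [x in sin x - _](_ : x = (x + y) / 2 + (x - y) / 2); last by field.
  rewrite [y in _ - sin y](_ : y = (x + y) / 2 - (x - y) / 2); last by field.
  by rewrite sinD sinB; ring.
rewrite !normrM; have h1 := normr_sin_le ((x - y) / 2); have h2 := cos_max ((x + y) / 2).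
apply: (@le_trans _ _ (2 * (`|(x - y) / 2| * 1))).
  by rewrite normr_nat ler_wpM2l // ler_pM.
by rewrite normrM (@ger0_norm _ 2^-1) // mulr1; lra.
Qed.

Variables (F : {poly int}).
Hypothesis F_odd : forall j, ~~ odd j -> F`_j = 0.

Definition phase (a : int) (q k : nat) : R := 2 * pi * ((a * F.[k%:Z])%:~R / q%:R).

(** The real part of the complete exponential sum G(a,q); [sum_sin_phase] shows that the imaginary
    part is zero. *)
Definition complete_sum (a : int) (q : nat) : R := \sum_(0 <= k < q) cos (phase a q k).

Let intr_shift (a z m : int) (q : nat) :
  (a * (z + m * q%:Z))%:~R = (a * z)%:~R + (a * m)%:~R * q%:R :> R.
Proof. by rewrite mulrDr intrD mulrA [(a * m * q%:Z)%:~R]intrM -pmulrn. Qed.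

Lemma phase_period a q k : (0 < q)%N ->
  exists m : int, phase a q (k + q) = phase a q k + m%:~R * (2 * pi).
Proof.
move=> q0; have [m hm] := horner_int_sub_dvd F (k + q)%:Z k.
have qR : q%:R != 0 :> R by rewrite pnatr_eq0 -lt0n.
exists (a * m); rewrite /phase.
have -> : F.[(k + q)%:Z] = F.[k%:Z] + m * q%:Z.
  by rewrite -(subrK F.[k%:Z] F.[(k + q)%:Z]) hm PoszD addrC [_ + q%:Z]addrC addrK.
by rewrite intr_shift; field.
Qed.

Lemma sin_phase_period a q k : (0 < q)%N -> sin (phase a q (k + q)) = sin (phase a q k).
Proof. by move=> /(phase_period a k) [m ->]; rewrite sin_intpi2. Qed.

Lemma cos_phase_period a q k : (0 < q)%N -> cos (phase a q (k + q)) = cos (phase a q k).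
Proof. by move=> /(phase_period a k) [m ->]; rewrite cos_intpi2. Qed.

Lemma sin_phase_reflect a q k : (0 < q)%N -> (k <= q)%N ->
  sin (phase a q (q - k)) = - sin (phase a q k).
Proof.
move=> q0 kq; have [m hm] := horner_int_sub_dvd F (q - k)%N%:Z (- k%:Z).
have qR : q%:R != 0 :> R by rewrite pnatr_eq0 -lt0n.
rewrite -sinN -(sin_intpi2 (a * m) (- _)); congr sin; rewrite /phase.
have -> : F.[(q - k)%N%:Z] = - F.[k%:Z] + m * q%:Z.
  rewrite -(subrK F.[- k%:Z] F.[(q - k)%N%:Z]) hm horner_odd // addrC.
  by rewrite -subzn // opprK subrK.
by rewrite intr_shift mulrN mulrNz; field.
Qed.

(** The reflection [k -> q - k] changes the sign of each term, [F] being odd. This zero is the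
    coefficient of the smooth cosine in the addition formula. *)
Lemma sum_sin_phase a q : (0 < q)%N -> \sum_(0 <= k < q) sin (phase a q k) = 0.
Proof.
move=> q0; set S := LHS.
have F0 : sin (phase a q 0) = 0.
  have h := sin_phase_reflect a q0 (leq0n q).
  have := sin_phase_period a 0 q0; rewrite add0n -[X in phase a q X]subn0 h; lra.
have E : \sum_(0 <= k < q) sin (phase a q k) = \sum_(1 <= k < q) sin (phase a q k).
  by rewrite big_ltn // F0 add0r.
have : S = - S.
  rewrite /S E {1}big_nat_rev -sumrN; apply: eq_big_nat => k /andP[k1 kq].
  by rewrite add1n subSS sin_phase_reflect // ltnW.
lra.
Qed.

(** With the slow phase frozen at its value at [u], the sum over a full period vanishes exactly;
    unfreezing costs [V] in each of the two sines. *)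
Lemma run_sum_le (a : int) (q u : nat) (be V : R) : (0 < q)%N ->
  (forall k, (u <= k < u + q)%N -> `|2 * pi * be * (F.[k%:Z] - F.[u%:Z])%:~R| <= V) ->
  `|\sum_(u <= k < u + q) (sin (2 * pi * (a%:~R / q%:R + be) * (F.[k%:Z])%:~R) -
     complete_sum a q / q%:R * sin (2 * pi * be * (F.[k%:Z])%:~R))| <= 2 * q%:R * V.
Proof.
move=> q0 hV; set G := complete_sum a q.
pose b k : R := 2 * pi * be * (F.[k%:Z])%:~R.
have qR : 0 < q%:R :> R by rewrite ltr0n.
have G1 : `|G / q%:R| <= 1.
  rewrite normrM normfV normr_nat ler_pdivrMr // mul1r; exact: norm_sum_cos_le.
have Z : \sum_(u <= k < u + q) (sin (phase a q k + b u) - G / q%:R * sin (b u)) = 0.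
  rewrite sumrB sumr_const_nat addKn -mulr_natr.
  under eq_bigr do rewrite sinD.
  rewrite big_split /= -!mulr_suml.
  rewrite (sum_periodic (f := fun k => sin (phase a q k))); last by move=> k; exact: sin_phase_period.
  rewrite (sum_periodic (f := fun k => cos (phase a q k))); last by move=> k; exact: cos_phase_period.
  rewrite sum_sin_phase // -/(complete_sum a q) -/G mul0r add0r.
  by field; rewrite gt_eqF.
rewrite -[X in `|X|]subr0 -[X in _ - X]Z -sumrB.
apply: le_trans (ler_norm_sum _ _ _) _.
apply: (@le_trans _ _ (\sum_(u <= k < u + q) (2 * V))); last first.
  by rewrite sumr_const_nat addKn -mulr_natr; lra.
rewrite big_nat [leRHS]big_nat; apply: ler_sum => k hk.
have bk : `|b k - b u| <= V.
  by rewrite /b -mulrBr -intrB hV.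
have -> : 2 * pi * (a%:~R / q%:R + be) * (F.[k%:Z])%:~R = phase a q k + b k.
  by rewrite /phase /b intrM; ring.
rewrite (_ : _ - _ = (sin (phase a q k + b k) - sin (phase a q k + b u)) -
   G / q%:R * (sin (b k) - sin (b u))); last by rewrite /b; ring.
apply: le_trans (ler_normB _ _) _; rewrite mulr2n mulrDl mul1r; apply: lerD.
  by apply: le_trans (sin_lipschitz _ _) _; rewrite (_ : _ - _ = b k - b u) //; ring.
rewrite normrM -[leRHS]mul1r; apply: ler_pM => //.
exact: le_trans (sin_lipschitz _ _) bk.
Qed.

Lemma block_sum_le (a : int) (q N L : nat) (be V : R) : (0 < q)%N -> (N <= L)%N -> 0 <= V ->
  (forall u k, (N <= u)%N -> (u <= k < u + q)%N -> (k < L)%N ->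
     `|2 * pi * be * (F.[k%:Z] - F.[u%:Z])%:~R| <= V) ->
  `|\sum_(N <= k < L) sin (2 * pi * (a%:~R / q%:R + be) * (F.[k%:Z])%:~R)| <=
    `|complete_sum a q| / q%:R * `|\sum_(N <= k < L) sin (2 * pi * be * (F.[k%:Z])%:~R)|
    + 2 * (L - N)%:R * V + 2 * q%:R.
Proof.
move=> q0 NL V0 hV; set G := complete_sum a q.
have qR : 0 < q%:R :> R by rewrite ltr0n.
pose D k : R := sin (2 * pi * (a%:~R / q%:R + be) * (F.[k%:Z])%:~R) -
     G / q%:R * sin (2 * pi * be * (F.[k%:Z])%:~R).
have G1 : `|G / q%:R| <= 1.
  rewrite normrM normfV normr_nat ler_pdivrMr // mul1r; exact: norm_sum_cos_le.
have runs n : (N + n * q <= L)%N -> `|\sum_(N <= k < N + n * q) D k| <= 2 * (n * q)%:R * V.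
  elim: n => [|n IH] hn; first by rewrite mul0n addn0 big_geq // normr0 mulr0 mul0r.
  have hn' : (N + n * q <= L)%N by apply: leq_trans hn; rewrite leq_add2l leq_mul2r leqnSn orbT.
  have -> : (N + n.+1 * q = N + n * q + q)%N by rewrite mulSn; ring.
  rewrite (@big_cat_nat _ _ _ (N + n * q)%N) ?leq_addr //=.
  apply: le_trans (ler_normD _ _) _; rewrite mulSn natrD mulrDr mulrDl [leRHS]addrC.
  apply: lerD; first exact: IH.
  apply: run_sum_le => // k hk; apply: hV => //; first exact: leq_addr.
  by case/andP: hk => _ /leq_trans; apply; rewrite mulSn addnCA addnC in hn.
have total : `|\sum_(N <= k < L) D k| <= 2 * (L - N)%:R * V + 2 * q%:R.
  (* Full runs of length [q], then fewer than [q] leftover terms, each at most 2. *)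
  pose n := ((L - N) %/ q)%N.
  have nq : (N + n * q <= L)%N by rewrite -leq_subRL // leq_trunc_div.
  have rest : (L - (N + n * q) <= q)%N.
    rewrite subnDA {1}(divn_eq (L - N) q) addnC -/n addnK; apply: ltnW; exact: ltn_pmod.
  rewrite (@big_cat_nat _ _ _ (N + n * q)%N) ?leq_addr //=.
  apply: le_trans (ler_normD _ _) _; apply: lerD.
    apply: le_trans (runs n nq) _; rewrite ler_wpM2r // ler_wpM2l // ler_nat.
    by rewrite leq_trunc_div.
  apply: le_trans (ler_norm_sum _ _ _) _.
  apply: (@le_trans _ _ (\sum_(N + n * q <= k < L) 2)).
    apply: ler_sum => k _; apply: le_trans (ler_normB _ _) _.
    rewrite mulr2n; apply: lerD; first exact: sin_max.
    rewrite normrM -[leRHS]mul1r; apply: ler_pM => //; exact: sin_max.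
  by rewrite sumr_const_nat -[leLHS]mulr_natr ler_wpM2l // ler_nat.
have -> : \sum_(N <= k < L) sin (2 * pi * (a%:~R / q%:R + be) * (F.[k%:Z])%:~R) =
  G / q%:R * (\sum_(N <= k < L) sin (2 * pi * be * (F.[k%:Z])%:~R)) + \sum_(N <= k < L) D k.
  rewrite mulr_sumr -big_split /=; apply: eq_bigr => k _; rewrite /D; ring.
apply: le_trans (ler_normD _ _) _; rewrite -addrA; apply: lerD => //.
by rewrite !normrM normfV normr_nat.
Qed.

End CompleteSums.

(** * Growth of the phase and the smooth sum *)

Section Growth.
Context {R : realType}.

Lemma norm_sum_powers_le (c : nat -> R) (n k : nat) : (0 < k)%N ->
  `|\sum_(i < n.+1) c i * k%:R ^+ i| <= (\sum_(i < n.+1) `|c i|) * k%:R ^+ n.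
Proof.
move=> k0; apply: le_trans (ler_norm_sum _ _ _) _; rewrite mulr_suml.
apply: ler_sum => i _; rewrite normrM ler_wpM2l // normrX normr_nat.
by rewrite ler_weXn2l ?ler1n // -ltnS.
Qed.

Lemma poly_upper_growth (P : {poly R}) n : (size P <= n.+1)%N ->
  exists2 C : R, 0 < C & forall k : nat, (0 < k)%N -> `|P.[k%:R]| <= C * k%:R ^+ n.
Proof.
move=> sP; exists (\sum_(i < n.+1) `|P`_i| + 1) => [|k k0].
  by rewrite ltr_wpDl // sumr_ge0.
rewrite (horner_coef_wide _ sP) (le_trans (norm_sum_powers_le (fun i => P`_i) n k0)) //.
by rewrite ler_wpM2r ?exprn_ge0 // lerDl.
Qed.

Lemma poly_lower_growth (P : {poly R}) n : (size P <= n.+1)%N -> 0 < P`_n ->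
  exists n0 : nat, forall k : nat, (n0 <= k)%N -> P`_n / 2 * k%:R ^+ n <= P.[k%:R].
Proof.
case: n => [|n] sP Pn.
  exists 0%N => k _; rewrite (horner_coef_wide _ sP) big_ord1 expr0 !mulr1; lra.
set l := P`_n.+1 in Pn *; pose C := \sum_(i < n.+1) `|P`_i|.
exists (Num.truncn (2 * C / l)).+1 => k hk.
have k0 : (0 < k)%N by apply: leq_trans hk.
have kC : C <= l / 2 * k%:R.
  have : 2 * C / l < k%:R by apply: lt_le_trans (truncnS_gt _) _; rewrite ler_nat.
  by rewrite ltr_pdivrMr // => h; lra.
rewrite (horner_coef_wide _ sP) big_ord_recr /= -/l.
have := norm_sum_powers_le (fun i => P`_i) n k0; rewrite -/C /= ler_norml => /andP[h1 _].
have : C * k%:R ^+ n <= l / 2 * k%:R ^+ n.+1.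
  by rewrite exprS mulrA ler_wpM2r ?exprn_ge0.
by move: (\sum_(_ < _) _) h1 => S h1 h2; lra.
Qed.

Lemma intr_horner (F : {poly int}) (k : nat) :
  (F.[k%:Z])%:~R = (map_poly intr F).[k%:R] :> R.
Proof. by rewrite pmulrn -horner_map. Qed.

Lemma phase_growth (F : {poly int}) n : (size F <= n.+3)%N -> 0 < F`_n.+2 ->
  exists (n0 : nat) (C c0 : R), [/\ 0 < C, 0 < c0, c0 <= C,
    forall k, (0 < k)%N -> `|(F.[k%:Z])%:~R| <= C * k%:R ^+ n.+2 &
    forall k, (n0 <= k)%N -> (0 < k)%N ->
      [/\ c0 * k%:R ^+ n.+1 <= (F.[k.+1%:Z] - F.[k%:Z])%:~R,
          (F.[k.+1%:Z] - F.[k%:Z])%:~R <= C * k%:R ^+ n.+1 &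
          ((F.[k.+1%:Z] - F.[k%:Z])%:~R <= (F.[k.+2%:Z] - F.[k.+1%:Z])%:~R :> R)]].
Proof.
move=> sF Fn; pose P : {poly R} := map_poly intr F.
have sP : (size P <= n.+3)%N by apply: leq_trans (size_poly _ _) sF.
have Pn : 0 < P`_n.+2 by rewrite coef_map /= ltr0z.
pose P1 := poly_diff 1 P; pose P2 := poly_diff 1 P1.
have [sP1 cP1] := poly_diff_size_coef 1 sP; rewrite -/P1 /= in sP1 cP1.
have [sP2 cP2] := poly_diff_size_coef 1 sP1; rewrite -/P2 /= in sP2 cP2.
have P1n : 0 < P1`_n.+1 by rewrite cP1 mulr1 mulr_gt0.
have P2n : 0 < P2`_n by rewrite cP2 mulr1 mulr_gt0.
have P1E k : (F.[k.+1%:Z] - F.[k%:Z])%:~R = P1.[k%:R].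
  by rewrite intrB !intr_horner /P1 horner_poly_diff natr1.
have P2E k : P1.[k.+1%:R] - P1.[k%:R] = P2.[k%:R].
  by rewrite /P2 horner_poly_diff natr1.
have [C0 C00 hC0] := poly_upper_growth sP.
have [C1 C10 hC1] := poly_upper_growth sP1.
have [n1 hn1] := poly_lower_growth sP1 P1n.
have [n2 hn2] := poly_lower_growth sP2 P2n.
(* The last summand of the constant secures [c0 <= C]. *)
exists (maxn n1 n2), (C0 + C1 + P1`_n.+1 / 2), (P1`_n.+1 / 2); split; try lra.
- move=> k k0; rewrite intr_horner -/P; apply: le_trans (hC0 k k0) _.
  by rewrite ler_wpM2r ?exprn_ge0 //; lra.
move=> k; rewrite geq_max => /andP[k1 k2] k0; split.
- by rewrite P1E hn1.
- rewrite P1E; apply: le_trans (ler_norm _) _; apply: le_trans (hC1 k k0) _.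
  by rewrite ler_wpM2r ?exprn_ge0 //; lra.
rewrite !P1E -subr_ge0 P2E; apply: le_trans (hn2 k k2).
by rewrite mulr_ge0 ?exprn_ge0 //; lra.
Qed.

(** Small [y] is covered by [|sin u| <= |u|], large [y] by [kuzmin_landau]; the hypothesis on
    [(r * N) ^ n.+1] keeps all increments below [pi], so only one window occurs. *)
Lemma smooth_sum_le (h : nat -> R) (n n0 r N L : nat) (C c0 be : R) :
  0 < C -> 0 < c0 -> c0 <= C ->
  (forall k, (0 < k)%N -> `|h k| <= C * k%:R ^+ n.+2) ->
  (forall k, (n0 <= k)%N -> (0 < k)%N ->
      [/\ c0 * k%:R ^+ n.+1 <= h k.+1 - h k, h k.+1 - h k <= C * k%:R ^+ n.+1 &
          h k.+1 - h k <= h k.+2 - h k.+1]) ->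
  (0 < N)%N -> (n0 <= N)%N -> (N <= L <= r * N)%N ->
  2 * `|be| * C * (r * N)%:R ^+ n.+1 <= 1 ->
  `|\sum_(N <= k < L) sin (2 * pi * be * h k)| <=
    N%:R * (4 * (8 * C * r%:R ^+ n.+3 + 3 / c0) * hump (`|be| * N%:R ^+ n.+2)).
Proof.
move=> C0 c00 c0C up diff N0 n0N /andP[NL LN].
have p2 := pi_ge2 R; have p4 : pi <= 4 :> R by have := @pihalf_lt2 R; lra.
have -> : `|\sum_(N <= k < L) sin (2 * pi * be * h k)| =
   `|\sum_(N <= k < L) sin (2 * pi * h k * `|be|)|.
  rewrite -norm_sum_sin_norm; congr `|_|; apply: eq_bigr => k _; congr sin; ring.
move: (normr_ge0 be); move: `|be| => {}be be0 small.
have NR : 0 < N%:R :> R by rewrite ltr0n.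
have N1 : 1 <= N%:R :> R by rewrite ler1n.
have r0 : (0 < r)%N by case: r LN {small} => // ; rewrite mul0n; case: L NL => //; rewrite leqn0 => /eqP E; rewrite E in N0.
have rR : 1 <= r%:R :> R by rewrite ler1n.
rewrite [leRHS]mulrC -ler_pdivrMr //.
set A := 8 * C * r%:R ^+ n.+3 + 3 / c0.
have A1 : 0 <= 8 * C * r%:R ^+ n.+3.
  by apply: mulr_ge0; [apply: mulr_ge0 => //; exact: ltW|exact: exprn_ge0].
have A2 : 0 <= 3 / c0 by rewrite divr_ge0 ?(ltW c00).
have Np m : 0 < N%:R ^+ m :> R by rewrite exprn_gt0.
have C0' : 0 <= C := ltW C0.
apply: le_hump; [exact: addr_ge0|by apply: mulr_ge0 => //; exact: ltW| |].
  move=> _; rewrite ler_pdivrMr //.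
  apply: (@le_trans _ _ ((L - N)%:R * (2 * pi * be * (C * (r * N)%:R ^+ n.+2)))).
    apply: norm_sum_sin_small => k /andP[Nk kL].
    have k0 : (0 < k)%N by apply: leq_trans Nk.
    rewrite mulrAC normrM ger0_norm; last by rewrite !mulr_ge0 //; lra.
    rewrite ler_wpM2l ?mulr_ge0 //; first by lra.
    apply: le_trans (up k k0) _; rewrite ler_wpM2l ?(ltW C0) //.
    by rewrite lerXn2r ?nnegrE // ler_nat ltnW // (leq_trans kL).
  apply: (@le_trans _ _ ((r * N)%:R * (8 * be * (C * (r * N)%:R ^+ n.+2)))).
    apply: ler_pM => //.
    - apply: mulr_ge0; [by rewrite !mulr_ge0 //; lra|by apply: mulr_ge0 => //; exact: exprn_ge0].
    - by rewrite ler_nat (leq_trans (leq_subr _ _)).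
    apply: ler_wpM2r; first by apply: mulr_ge0 => //; exact: exprn_ge0.
    by apply: ler_wpM2r => //; lra.
  have -> : (r * N)%:R * (8 * be * (C * (r * N)%:R ^+ n.+2)) =
     8 * C * r%:R ^+ n.+3 * (be * N%:R ^+ n.+2) * N%:R :> R.
    by rewrite natrM exprMn [r%:R ^+ n.+3]exprS; ring.
  apply: ler_wpM2r => //; apply: ler_wpM2r; first by apply: mulr_ge0 => //; exact: exprn_ge0.
  by rewrite /A lerDl.
move=> y1.
have be00 : 0 < be.
  rewrite lt_neqAle be0 andbT; apply/eqP => be00; move: y1; rewrite -be00 mul0r; lra.
pose th := 2 * pi * be * (c0 * N%:R ^+ n.+1).
have th0 : 0 < th by rewrite !mulr_gt0 //; lra.
have mon k m : (k <= m)%N -> k%:R ^+ n.+1 <= m%:R ^+ n.+1 :> R.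
  by move=> km; rewrite lerXn2r ?nnegrE // ler_nat.
have cap k : (k <= r * N)%N -> 2 * pi * be * (C * k%:R ^+ n.+1) <= pi.
  move=> km; apply: (@le_trans _ _ (pi * (2 * be * C * (r * N)%:R ^+ n.+1))); last first.
    by rewrite -[leRHS]mulr1 ler_wpM2l //; lra.
  rewrite [leLHS](_ : _ = pi * (2 * be * C * k%:R ^+ n.+1)); last by ring.
  apply: ler_wpM2l; first lra.
  by apply: ler_wpM2l; [rewrite !mulr_ge0 // ltW|exact: mon].
have thpi : th <= pi.
  apply: le_trans (cap N _); last by rewrite leq_pmull.
  by rewrite /th ler_wpM2l ?mulr_ge0 // ?ler_wpM2r //; lra.
have KL : `|\sum_(N <= k < L) sin (2 * pi * h k * be)| <= 1 + 8 / th.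
  apply: kuzmin_landau => // k.
    move=> /andP[Nk kL]; have [h1 h2 _] := diff k (leq_trans n0N Nk) (leq_trans N0 Nk).
    rewrite -mulrBl -mulrBr [_ * be]mulrAC.
    have b1 : th <= 2 * pi * be * (h k.+1 - h k).
      apply: ler_wpM2l; first by rewrite !mulr_ge0 //; lra.
      by apply: le_trans h1; rewrite ler_wpM2l ?(ltW c00) // mon.
    have b2 : 2 * pi * be * (h k.+1 - h k) <= pi.
      apply: le_trans (cap k _); last by rewrite ltnW // (leq_trans kL).
      by apply: ler_wpM2l; rewrite ?mulr_ge0 //; lra.
    by rewrite b1 /=; lra.
  move=> Nk kL; have [_ _ h3] := diff k (leq_trans n0N Nk) (leq_trans N0 Nk).
  rewrite -!mulrBl -!mulrBr ler_wpM2r // ler_wpM2l // mulr_ge0 //; lra.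
rewrite ler_pdivrMr //; apply: le_trans KL _.
have cN : 0 < c0 * N%:R ^+ n.+1 by apply: mulr_gt0.
have X00 : 0 < be * (c0 * N%:R ^+ n.+1) by apply: mulr_gt0.
have e1 : 8 / th <= 2 / (be * (c0 * N%:R ^+ n.+1)).
  rewrite (_ : 2 / _ = 8 / (4 * (be * (c0 * N%:R ^+ n.+1)))); last by field; rewrite !gt_eqF.
  apply: ler_wpM2l => //; rewrite lef_pV2 ?posrE //; last by apply: mulr_gt0.
  rewrite /th -[leRHS]mulrA; apply: ler_wpM2r; first exact: ltW.
  by lra.
set X := be * (c0 * N%:R ^+ n.+1) in X00 e1.
have -> : A / (be * N%:R ^+ n.+2) * N%:R = A * c0 / X.
  by rewrite /X [N%:R ^+ n.+2]exprS; field; rewrite !gt_eqF.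
have e2 : 1 <= 1 / X.
  rewrite ler_pdivlMr //.
  have : pi * (2 * X) <= pi * 1 by rewrite mulr1; apply: le_trans thpi; rewrite /th /X; lra.
  by rewrite ler_pM2l; lra.
have : 3 / X <= A * c0 / X.
  by rewrite ler_wpM2r ?invr_ge0 ?(ltW X00) // -ler_pdivrMr // /A lerDr.
by rewrite -[3 / X]mulrC -[2 / X]mulrC -[1 / X]mulrC in e1 e2 *; lra.
Qed.

End Growth.

(** * Fractions attached to large sums *)

Section Arcs.
Context {R : realType}.

Lemma reduce_fraction (a : int) (q : nat) : (0 < q)%N ->
  exists (a' : int) (q' : nat), [/\ (0 < q' <= q)%N, coprime `|a'|%N q' &
    a%:~R / q%:R = a'%:~R / q'%:R :> R].
Proof.
move=> q0; set g := gcdn `|a|%N q.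
have g0 : (0 < g)%N by rewrite gcdn_gt0 q0 orbT.
have /dvdzP[a' ha] : (g%:Z %| a)%Z by rewrite dvdzE /= dvdn_gcdl.
have /dvdnP[q' hq] : (g %| q)%N by exact: dvdn_gcdr.
have q'0 : (0 < q')%N by move: q0; rewrite hq muln_gt0 => /andP[].
exists a', q'; split.
- by rewrite q'0 hq leq_pmulr.
- have : gcdn `|a|%N q = g by [].
  rewrite {1}ha {1}hq abszM /= -muln_gcdl => /eqP.
  by rewrite -[X in _ == X]mul1n eqn_pmul2r.
rewrite {1}ha {1}hq intrM natrM -pmulrn; field.
by rewrite !pnatr_eq0 -!lt0n q'0 g0.
Qed.

Section LeadingCoefficient.
Variables (n A b : nat) (F : {poly int}).
Hypothesis weyl : weyl_inverse (R := R) n.+2 A.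
Hypothesis sF : (size F <= n.+3)%N.
Hypothesis lF : F`_n.+2 = b%:Z.
Hypothesis b0 : (0 < b)%N.

Lemma large_sum_major (t : R) (N r T L : nat) : (2 <= T)%N -> (0 < r)%N -> (N <= L <= r * N)%N ->
  (r * N)%:R < T%:R * `|\sum_(N <= k < L) sin (2 * pi * t * (F.[k%:Z])%:~R)| ->
  exists (a : int) (q : nat), [/\ (0 < q <= b * T ^ A)%N, coprime `|a|%N q &
    `|t - a%:~R / q%:R| * N%:R ^+ n.+2 <= T%:R ^+ A].
Proof.
move=> T2 r0 /andP[NL LN] hS; pose P : {poly R} := map_poly intr F.
have sP : (size P <= n.+3)%N by apply: leq_trans (size_poly _ _) sF.
have cP : P`_n.+2 = b%:R by rewrite coef_map lF /= -pmulrn.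
have [sD _] := poly_diff_size_coef N%:R sP.
(* [Q] is [P] translated by [N], in a form showing that the leading coefficient is unchanged.
   Subtracting a quarter turn then makes the sines the cosines of [weyl_inverse]. *)
pose Q := P + poly_diff N%:R P.
have QE x : Q.[x] = P.[x + N%:R] by rewrite hornerD horner_poly_diff addrC subrK.
pose p := t *: Q - (1 / 4)%:P.
have sp : (size p <= n.+3)%N.
  apply: leq_trans (size_polyD _ _) _; rewrite size_polyN geq_max; apply/andP; split; last first.
    by apply: leq_trans (size_polyC_leq1 _) _.
  apply: leq_trans (size_scale_leq _ _) _; apply: leq_trans (size_polyD _ _) _.
  by rewrite geq_max sP /=; apply: leqW.
have cp : p`_n.+2 = t * b%:R.
  by rewrite coefB coefZ coefC /= subr0 coefD cP [(poly_diff _ _)`_ _]nth_default // addr0.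
have [|q [a [/andP[q0 qT] ha]]] := weyl T2 (leq_trans (leq_subr N L) LN) sp.
  move: hS; rewrite -[N in \sum_(N <= _ < _) _]add0n big_addn; congr (_ < _ * `|_|).
  apply: eq_bigr => k _; rewrite -cosBpihalf; congr cos.
  by rewrite hornerD hornerN hornerC hornerZ QE intr_horner natrD; field.
have qb0 : (0 < q * b)%N by rewrite muln_gt0 q0.
have [a' [q' [/andP[q'0 q'q] cop E]]] := reduce_fraction a qb0.
exists a', q'; split => //.
  by rewrite q'0 (leq_trans q'q) // mulnC leq_mul2l qT orbT.
rewrite -E; apply: le_trans ha; rewrite cp.
have qbR : 0 < (q * b)%:R :> R by rewrite ltr0n.
have -> : q%:R * (t * b%:R) - a%:~R = (q * b)%:R * (t - a%:~R / (q * b)%:R).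
  by rewrite natrM; field; rewrite !pnatr_eq0 -!lt0n q0 b0.
rewrite normrM normr_nat; apply: ler_pM => //; rewrite ?exprn_ge0 //.
  by rewrite ler_peMl // ler1n.
by rewrite lerXn2r ?nnegrE // ler_nat leq_pmull.
Qed.

(** A larger sum would put [a * b / q] near a fraction of denominator [q' <= T ^ A]. Equality forces
    [q] to divide [q' * b]; otherwise the distance is at least [1 / q] before scaling by [q ^ n.+2].
    Both contradict the size of [q]. *)
Lemma complete_sum_bound (a : int) (q T : nat) : (2 <= T)%N -> coprime `|a|%N q ->
  (b * T ^ A < q)%N -> T%:R * `|complete_sum F a q| <= q%:R :> R.
Proof.
move=> T2 cop hq; rewrite leNgt; apply/negP => hS.
have q0 : (0 < q)%N by apply: leq_trans hq.
have qR : 0 < q%:R :> R by rewrite ltr0n.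
pose p : {poly R} := (a%:~R / q%:R) *: map_poly intr F.
have sp : (size p <= n.+3)%N.
  by apply: leq_trans (size_scale_leq _ _) (leq_trans (size_poly _ _) sF).
have [|q' [a' [/andP[q'0 q'T] ha]]] := weyl T2 (leqnn q) sp.
  move: hS; rewrite /complete_sum; congr (_ < _ * `|_|).
  by apply: eq_bigr => k _; rewrite /phase hornerZ -intr_horner intrM; congr cos; ring.
pose m : int := q'%:Z * a * b%:Z - a' * q%:Z.
have mE : q'%:R * p`_n.+2 - a'%:~R = m%:~R / q%:R.
  rewrite coefZ coef_map lF /= /m intrB !intrM -!pmulrn.
  by field; rewrite gt_eqF.
have m0 : m != 0.
  apply/eqP => m0; have : (q%:Z %| q'%:Z * a * b%:Z)%Z.
    by apply/dvdzP; exists a'; apply/eqP; rewrite -subr_eq0; apply/eqP.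
  rewrite dvdzE !abszM /= mulnAC Gauss_dvdl; last by rewrite coprime_sym.
  move=> /dvdn_leq; rewrite muln_gt0 q'0 b0 => /(_ isT) h.
  have : (q <= b * T ^ A)%N by apply: leq_trans h _; rewrite mulnC leq_mul2l q'T orbT.
  by rewrite leqNgt hq.
have m1 : 1 <= `|m%:~R| :> R.
  by rewrite -intr_norm (_ : 1 = 1%:~R) // ler_int; lia.
move: ha; rewrite mE normrM normfV normr_nat exprS mulrA divfK ?gt_eqF //.
move=> ha; have : q%:R ^+ n.+1 <= T%:R ^+ A :> R.
  by apply: le_trans ha; rewrite ler_peMl // exprn_ge0.
rewrite -!natrX ler_nat => h2.
have : (q <= T ^ A)%N by apply: leq_trans h2; rewrite -[leqLHS]expn1 leq_pexp2l.
by rewrite leqNgt (leq_ltn_trans _ hq) // leq_pmull.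
Qed.

End LeadingCoefficient.

(* Scales i in the same class [e i] share the value [be i]; the classes are then
   summed geometrically. *)
Lemma sparse_hump_sum (P : pred nat) (e : nat -> nat) (be : nat -> R) (rho : R) I : 1 < rho ->
  (forall i, 0 <= be i) ->
  (forall i j, P i -> P j -> e i = e j -> be i = be j) ->
  \sum_(0 <= i < I | P i) (1 / 2) ^+ e i * hump (be i * rho ^+ i) <= 2 * (rho / (rho - 1)).
Proof.
move=> rho1 be0 same; pose E := (\sum_(0 <= i < I) e i).+1.
have hpos i : 0 <= hump (be i * rho ^+ i).
  by rewrite hump_ge0 // mulr_ge0 // exprn_ge0 //; lra.
have r0 : 0 <= rho / (rho - 1) by rewrite divr_ge0 //; lra.
have eE i : (i < I)%N -> (e i < E)%N.
  by move=> iI; rewrite ltnS (bigD1_seq i) ?iota_uniq ?mem_index_iota //= leq_addr.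
have -> : \sum_(0 <= i < I | P i) (1 / 2) ^+ e i * hump (be i * rho ^+ i) =
  \sum_(0 <= k < E) \sum_(0 <= i < I | P i && (e i == k)) (1 / 2) ^+ k * hump (be i * rho ^+ i).
  rewrite (exchange_big_dep P) /=; last by move=> k i _ /andP[].
  rewrite big_nat_cond [RHS]big_nat_cond; apply: eq_bigr => i /andP[/andP[_ iI] Pi].
  rewrite -big_filter (_ : [seq k <- _ | _] = [:: e i]) ?big_seq1 //.
  rewrite (eq_filter (a2 := pred1 (e i))); last by move=> k /=; rewrite Pi eq_sym.
  by rewrite filter_pred1_uniq ?iota_uniq // mem_index_iota /= eE.
apply: (@le_trans _ _ (\sum_(0 <= k < E) (1 / 2) ^+ k * (rho / (rho - 1)))).
  apply: ler_sum => k _; rewrite -mulr_sumr ler_wpM2l ?exprn_ge0 //.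
  (* Any member [j] represents its class, so that one value [be j] serves in [sum_hump_le]. *)
  have [[j Pj ej]|none] := pselect (exists2 j, P j & e j = k); last first.
    rewrite big1 // => i /andP[Pi /eqP ei]; case: none; by exists i.
  apply: le_trans (@sum_hump_le R rho (be j) I rho1 (be0 j)).
  rewrite big_mkcond; apply: ler_sum => i _; case: ifP => [/andP[Pi /eqP ei]|_].
    by rewrite (same i j) // ei ej.
  by rewrite hump_ge0 // mulr_ge0 // exprn_ge0 //; lra.
rewrite -mulr_suml ler_wpM2r // big_mkord.
have := subrX1 (1 / 2 : R) E.
have : 0 <= (1 / 2 : R) ^+ E by rewrite exprn_ge0.
lra.
Qed.

End Arcs.

(** * Uniform convergence for odd polynomials *)

Section PolynomialBlocks.
Context {R : realType}.
Variables (n A b : nat) (F : {poly int}).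
Hypothesis weyl : weyl_inverse (R := R) n.+2 A.
Hypothesis sF : (size F <= n.+3)%N.
Hypothesis lF : F`_n.+2 = b%:Z.
Hypothesis b0 : (0 < b)%N.
Hypothesis F_odd : forall j, ~~ odd j -> F`_j = 0.

(** With [N = T ^ (3 * A + 2)] these provide [T ^ A * T <= N] and [T ^ (2 * A) * T <= N], the room
    needed for a saving of one factor [T]. *)
Let exp_le1 : (A.+1 <= 3 * A + 2)%N. Proof. by lia. Qed.
Let exp_le2 : ((2 * A).+1 <= 3 * A + 2)%N. Proof. by lia. Qed.
Let exp_le3 : (A <= 2 * A)%N. Proof. by lia. Qed.

(* Blocks start at N = T ^ (3 A + 2), where T is a power of 2. *)
Definition major (t : R) (T : nat) (a : int) (q : nat) :=
  [/\ (0 < q <= b * T ^ A)%N, coprime `|a|%N q &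
      `|t - a%:~R / q%:R| * (T ^ (3 * A + 2))%:R ^+ n.+2 <= T%:R ^+ A].

(** [complete_sum_bound] applies with saving [2 ^ e], the logarithm's base being chosen so that
    [(2 ^ e) ^ A.+1 <= q]. If [2 ^ e] does not exceed [b], or [e = 0], the factor [b.+1] covers the
    trivial bound. *)
Lemma complete_sum_ratio (a : int) (q : nat) : (0 < q)%N -> coprime `|a|%N q ->
  `|complete_sum F a q| / q%:R <= (b.+1)%:R * (1 / 2) ^+ (trunc_log (2 ^ A.+1) q) :> R.
Proof.
move=> q0 cop; set e := trunc_log _ _.
have qR : 0 < q%:R :> R by rewrite ltr0n.
have /andP[eq _] : (((2 ^ A.+1) ^ e <= q) && (q < (2 ^ A.+1) ^ e.+1))%N.
  by apply: trunc_log_bounds => //; rewrite -[X in (X < _)%N](expn0 2) ltn_exp2l.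
have E0 : 0 < (2 ^ e)%:R :> R by rewrite ltr0n expn_gt0.
have -> : (1 / 2) ^+ e = ((2 ^ e)%:R)^-1 :> R by rewrite natrX div1r exprVn.
rewrite ler_pdivrMr // mulrAC ler_pdivlMr //.
have [big|small] := boolP ((2 <= 2 ^ e) && (b < 2 ^ e))%N.
  case/andP: big => E2 Eb.
  have := @complete_sum_bound R n A b F weyl sF lF b0 a q (2 ^ e) E2 cop.
  rewrite mulrC; move=> h; apply: le_trans (h _) _; last first.
    by rewrite ler_peMl ?ler1n // ler0n.
  apply: leq_trans eq; rewrite [((2 ^ A.+1) ^ e)%N]expnAC expnS ltn_pmul2r //.
  by rewrite expn_gt0 expn_gt0.
have Eb : (2 ^ e <= b.+1)%N.
  by move: small; rewrite negb_and -!ltnNge !ltnS => /orP[h|/leqW //]; apply: leq_trans h _.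
rewrite mulrC; apply: ler_pM => //; first by rewrite ler_nat.
exact: norm_sum_cos_le.
Qed.

(** Distinct fractions lie at least [1 / (q * q')] apart, yet both are within [T ^ -(2 * A + 1)] of
    [t]. Since [q'] is bounded through [q] and not through the possibly huge [T'], this would give
    [T <= 2 ^ A.+2 * b ^ 2]. *)
Lemma major_unique (t : R) (T T' : nat) (a a' : int) (q q' : nat) :
  (2 ^ A.+2 * b ^ 2 < T)%N -> (T <= T')%N -> major t T a q -> major t T' a' q' ->
  (q' < 2 ^ A.+1 * q)%N -> a%:~R / q%:R = a'%:~R / q'%:R :> R.
Proof.
move=> hT TT [/andP[q0 qT] _ h] [/andP[q'0 q'T] _ h'] qq.
apply/eqP/negPn/negP => ne.
have T0 : (0 < T)%N by apply: leq_ltn_trans hT.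
have qR : 0 < q%:R :> R by rewrite ltr0n.
have q'R : 0 < q'%:R :> R by rewrite ltr0n.
have near x (S : nat) : (0 < S)%N -> x * (S ^ (3 * A + 2))%:R ^+ n.+2 <= S%:R ^+ A -> 0 <= x ->
    x * S%:R ^+ (2 * A + 1) <= 1 :> R.
  move=> S0 hx x0; have S1 : 1 <= S%:R :> R by rewrite ler1n.
  rewrite -(@ler_pM2r _ (S%:R ^+ A)) ?exprn_gt0 ?ltr0n // mul1r; apply: le_trans hx.
  rewrite -mulrA ler_wpM2l // natrX -exprD -exprM ler_weXn2l //; nia.
have hb := near _ _ T0 h (normr_ge0 _).
have hb' : `|t - a'%:~R / q'%:R| * T%:R ^+ (2 * A + 1) <= 1.
  apply: le_trans (near _ _ (leq_trans T0 TT) h' (normr_ge0 _)).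
  by rewrite ler_wpM2l // lerXn2r ?nnegrE // ler_nat.
pose m : int := a * q'%:Z - a' * q%:Z.
have mE : m%:~R = (a%:~R / q%:R - a'%:~R / q'%:R) * (q%:R * q'%:R) :> R.
  by rewrite /m intrB !intrM -!pmulrn; field; rewrite !gt_eqF.
have m0 : m != 0.
  apply/eqP => m0; move: mE; rewrite m0 => /esym/eqP.
  by rewrite mulf_eq0 (gt_eqF (mulr_gt0 qR q'R)) orbF subr_eq0 (negbTE ne).
have m1 : 1 <= `|m%:~R| :> R.
  by rewrite -intr_norm (_ : 1 = 1%:~R) // ler_int; lia.
have TR : 0 < T%:R ^+ (2 * A + 1) :> R by rewrite exprn_gt0 // ltr0n.
have key : T%:R ^+ (2 * A + 1) <= 2 * (q%:R * q'%:R) :> R.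
  apply: (@le_trans _ _ (`|m%:~R| * T%:R ^+ (2 * A + 1))); first by rewrite ler_peMl // ltW.
  rewrite mE normrM (gtr0_norm (mulr_gt0 qR q'R)) mulrAC ler_wpM2r //.
  have -> : a%:~R / q%:R - a'%:~R / q'%:R = (t - a'%:~R / q'%:R) - (t - a%:~R / q%:R) by ring.
  apply: (@le_trans _ _ ((`|t - a'%:~R / q'%:R| + `|t - a%:~R / q%:R|) * T%:R ^+ (2 * A + 1))).
    by rewrite ler_wpM2r ?(ltW TR) // ler_normB.
  by rewrite mulrDl; lra.
move: key; rewrite -natrX -!natrM ler_nat => key.
have : (T ^ (2 * A + 1) <= 2 ^ A.+2 * b ^ 2 * T ^ (2 * A))%N.
  apply: leq_trans key _; apply: (@leq_trans (2 * ((b * T ^ A) * (2 ^ A.+1 * (b * T ^ A))))%N).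
    rewrite leq_mul2l /=; apply: leq_mul => //; apply: leq_trans (ltnW qq) _.
    by rewrite leq_mul2l qT orbT.
  by rewrite [(2 ^ A.+2)%N]expnS [(2 * A)%N]mul2n -addnn expnD -mulnn; apply/eq_leq; ring.
by rewrite addn1 expnS leq_pmul2r ?expn_gt0 ?T0 // leqNgt hT.
Qed.

Section Growing.
Variables (n0 : nat) (C c0 : R).
Hypothesis C0 : 0 < C.
Hypothesis c00 : 0 < c0.
Hypothesis c0C : c0 <= C.
Hypothesis growth : forall k, (0 < k)%N -> `|(F.[k%:Z])%:~R| <= C * k%:R ^+ n.+2.
Hypothesis growth1 : forall k, (n0 <= k)%N -> (0 < k)%N ->
      [/\ c0 * k%:R ^+ n.+1 <= (F.[k.+1%:Z] - F.[k%:Z])%:~R,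
          (F.[k.+1%:Z] - F.[k%:Z])%:~R <= C * k%:R ^+ n.+1 &
          ((F.[k.+1%:Z] - F.[k%:Z])%:~R <= (F.[k.+2%:Z] - F.[k.+1%:Z])%:~R :> R)].

Lemma phase_variation (M u k : nat) : (n0 <= u)%N -> (0 < u)%N -> (u <= k)%N -> (k <= M)%N ->
  `|(F.[k%:Z] - F.[u%:Z])%:~R| <= (k - u)%:R * (C * M%:R ^+ n.+1).
Proof.
move=> n0u u0 uk kM.
have -> : (F.[k%:Z] - F.[u%:Z])%:~R = \sum_(u <= j < k) (F.[j.+1%:Z] - F.[j%:Z])%:~R :> R.
  rewrite -(telescope_sumr (fun j => (F.[j%:Z] : int)) uk) raddf_sum.
  by apply: eq_bigr => j _.
apply: le_trans (ler_norm_sum _ _ _) _.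
rewrite mulr_natl -sumr_const_nat big_nat [leRHS]big_nat; apply: ler_sum => j /andP[uj jk].
have [h1 h2 _] := growth1 (leq_trans n0u uj) (leq_trans u0 uj).
have p0 m : 0 <= m%:R ^+ n.+1 :> R by rewrite exprn_ge0.
rewrite ger0_norm; last by apply: le_trans h1; apply: mulr_ge0 => //; exact: ltW.
apply: le_trans h2 _; rewrite ler_wpM2l ?(ltW C0) // lerXn2r ?nnegrE //.
by rewrite ler_nat ltnW // (leq_trans jk).
Qed.

(** Over a run of length [q] the slow phase varies by at most [V]; as [q <= b * T ^ A] and
    [|be| * N ^ n.+2 <= T ^ A], the total error is of order [T ^ (2 * A)], hence at most of order
    [N / T]. *)
Lemma major_block_le (t : R) (T r L : nat) (a : int) (q : nat) :
  let N := (T ^ (3 * A + 2))%N in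
  (0 < T)%N -> (0 < r)%N -> (N <= L <= r * N)%N -> major t T a q -> (n0 <= N)%N ->
  2 * C * r%:R ^+ n.+1 <= T%:R ->
  `|\sum_(N <= k < L) sin (2 * pi * t * (F.[k%:Z])%:~R)| <=
    N%:R * ((16 * b%:R * C * r%:R ^+ n.+2 + 2 * b%:R) / T%:R + `|complete_sum F a q| / q%:R *
      (4 * (8 * C * r%:R ^+ n.+3 + 3 / c0) * hump (`|t - a%:~R / q%:R| * N%:R ^+ n.+2))).
Proof.
move=> N T0 r0 /andP[NL LN] [/andP[q0 qT] _ hm] n0N CT.
have N0 : (0 < N)%N by rewrite expn_gt0 T0.
have NR : 0 < N%:R :> R by rewrite ltr0n.
have TR : 0 < T%:R :> R by rewrite ltr0n.
have T1 : 1 <= T%:R :> R by rewrite ler1n.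
have qR : 0 < q%:R :> R by rewrite ltr0n.
have p2 := pi_ge2 R; have p4 : pi <= 4 :> R by have := @pihalf_lt2 R; lra.
set be := t - a%:~R / q%:R in hm *.
have tE : t = a%:~R / q%:R + be by rewrite /be addrC subrK.
have C0' := ltW C0.
have M0 m : 0 <= (r * N)%:R ^+ m :> R by rewrite exprn_ge0.
pose V := 8 * `|be| * q%:R * (C * (r * N)%:R ^+ n.+1).
have V0 : 0 <= V by apply: mulr_ge0; [rewrite !mulr_ge0|exact: mulr_ge0].
have NE : N%:R = T%:R ^+ (3 * A + 2) :> R by rewrite natrX.
rewrite tE.
have := @block_sum_le R F F_odd a q N L be V q0 NL V0.
have /[swap] /[apply] : forall u k, (N <= u)%N -> (u <= k < u + q)%N -> (k < L)%N ->
     `|2 * pi * be * (F.[k%:Z] - F.[u%:Z])%:~R| <= V.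
  move=> u k Nu /andP[uk kuq] kL.
  have h := phase_variation (leq_trans n0N Nu) (leq_trans N0 Nu) uk (ltnW (leq_trans kL LN)).
  rewrite !normrM normr_nat (ger0_norm (pi_ge0 R)).
  rewrite [V](_ : _ = 8 * `|be| * (q%:R * (C * (r * N)%:R ^+ n.+1))); last by rewrite /V; ring.
  apply: ler_pM => //; first by rewrite !mulr_ge0 //; lra.
    by rewrite ler_wpM2r //; lra.
  apply: le_trans h _; apply: ler_wpM2r; first exact: mulr_ge0.
  by rewrite ler_nat leq_subLR ltnW.
move=> hS; apply: le_trans hS _.
have pN m : 0 < N%:R ^+ m :> R by rewrite exprn_gt0.
have beN : `|be| * N%:R ^+ n.+1 * T%:R <= 1.
  rewrite -(@ler_pM2r _ N%:R) // mul1r.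
  rewrite [leLHS](_ : _ = `|be| * N%:R ^+ n.+2 * T%:R); last by rewrite [N%:R ^+ n.+2]exprSr; ring.
  apply: (@le_trans _ _ (T%:R ^+ A * T%:R)); first by rewrite ler_wpM2r.
  by rewrite -exprSr NE ler_weXn2l.
have small : 2 * `|be| * C * (r * N)%:R ^+ n.+1 <= 1.
  apply: le_trans beN.
  rewrite natrM exprMn [leLHS](_ : _ = `|be| * N%:R ^+ n.+1 * (2 * C * r%:R ^+ n.+1)); last by ring.
  by apply: ler_wpM2l => //; apply: mulr_ge0 => //; exact: ltW.
have diff k : (n0 <= k)%N -> (0 < k)%N ->
  [/\ c0 * k%:R ^+ n.+1 <= (F.[k.+1%:Z])%:~R - (F.[k%:Z])%:~R,
      (F.[k.+1%:Z])%:~R - (F.[k%:Z])%:~R <= C * k%:R ^+ n.+1 &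
      (F.[k.+1%:Z])%:~R - (F.[k%:Z])%:~R <= (F.[k.+2%:Z])%:~R - (F.[k.+1%:Z])%:~R :> R].
  by move=> k1 k2; have := growth1 k1 k2; rewrite !intrB.
have smooth := @smooth_sum_le R (fun k => (F.[k%:Z])%:~R) n n0 r N L C c0 be
  C0 c00 c0C growth diff N0 n0N.
rewrite NL LN in smooth; have {}smooth := smooth isT small.
rewrite [leRHS]mulrDr [leRHS]addrC -addrA; apply: lerD.
  by rewrite mulrCA; apply: ler_wpM2l.
have eN : T%:R ^+ (2 * A) * T%:R <= N%:R :> R.
  by rewrite -exprSr NE ler_weXn2l.
have qTR : q%:R <= b%:R * T%:R ^+ A :> R by rewrite -natrX -natrM ler_nat.
have LNR : (L - N)%:R <= (r * N)%:R :> R by rewrite ler_nat (leq_trans (leq_subr _ _)).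
apply: (@le_trans _ _ ((16 * b%:R * C * r%:R ^+ n.+2 + 2 * b%:R) * T%:R ^+ (2 * A))); last first.
  rewrite [leRHS]mulrCA; apply: ler_wpM2l.
    apply: addr_ge0; last exact: mulr_ge0.
    by apply: mulr_ge0; [rewrite !mulr_ge0|exact: exprn_ge0].
  by rewrite ler_pdivlMr.
rewrite [leRHS]mulrDl; apply: lerD; last first.
  rewrite -mulrA; apply: ler_wpM2l => //; apply: le_trans qTR _.
  by rewrite ler_wpM2l // ler_weXn2l.
apply: (@le_trans _ _ (2 * (r * N)%:R * V)).
  by apply: ler_wpM2r => //; apply: ler_wpM2l.
rewrite /V.
have -> : 2 * (r * N)%:R * (8 * `|be| * q%:R * (C * (r * N)%:R ^+ n.+1)) =
  (16 * C * r%:R ^+ n.+2) * (q%:R * (`|be| * N%:R ^+ n.+2)) :> R.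
  by rewrite !natrM !exprMn [N%:R ^+ n.+2]exprS [r%:R ^+ n.+2]exprS; ring.
rewrite [leRHS](_ : _ = (16 * C * r%:R ^+ n.+2) * ((b%:R * T%:R ^+ A) * T%:R ^+ A)); last first.
  by rewrite mul2n -addnn exprD; ring.
apply: ler_wpM2l; first by apply: mulr_ge0; [exact: mulr_ge0|exact: exprn_ge0].
by apply: ler_pM => //; apply: mulr_ge0 => //; exact: ltW.
Qed.

End Growing.

Lemma polynomial_blocks : exists (r : nat) (K : R), (1 < r)%N /\
  forall t : R, exists w : nat -> R, [/\ forall i, 0 <= w i,
    forall I, \sum_(0 <= i < I) w i <= K &
    forall i L, (r ^ i <= L <= r ^ i.+1)%N ->
      `|\sum_(r ^ i <= k < L) sin (2 * pi * t * (F.[k%:Z])%:~R)| <= (r ^ i)%:R * w i].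
Proof.
have Fn : 0 < F`_n.+2 by rewrite lF.
have [n0 [C [c0 [C0 c00 c0C growth growth1]]]] := @phase_growth R F n sF Fn.
pose r := (2 ^ (3 * A + 2))%N.
have r1 : (1 < r)%N by rewrite -[X in (X < _)%N](expn0 2) ltn_exp2l // addn2.
have r0 : (0 < r)%N by apply: ltnW.
have rE i : (r ^ i = (2 ^ i) ^ (3 * A + 2))%N by rewrite /r expnAC.
(* From scale [i0] on, [r ^ i] exceeds [n0], and [2 ^ i] meets the size conditions of
   [major_block_le] and [major_unique]. *)
pose i0 := (n0 + (Num.truncn (2 * C * r%:R ^+ n.+1)).+1 + 2 ^ A.+2 * b ^ 2)%N.
(* The first two summands pay for the error of [major_block_le], [r] for scales without a major
   fraction, and the last for the scales below [i0]. *)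
pose K1 := 16 * b%:R * C * r%:R ^+ n.+2 + 2 * b%:R + r%:R + r%:R * (2 ^ i0)%:R : R.
pose K2 := b.+1%:R * (4 * (8 * C * r%:R ^+ n.+3 + 3 / c0)) : R.
pose rho := r%:R ^+ n.+2 : R.
have rR : 1 < r%:R :> R by rewrite ltr1n.
have rho1 : 1 < rho by rewrite exprn_egt1.
have C0' := ltW C0.
have G1 : 0 <= 16 * b%:R * C * r%:R ^+ n.+2 + 2 * b%:R :> R.
  apply: addr_ge0; last exact: mulr_ge0.
  by apply: mulr_ge0; [rewrite !mulr_ge0|exact: exprn_ge0].
have K10 : 0 <= K1 by rewrite /K1; apply: addr_ge0; [apply: addr_ge0|apply: mulr_ge0].
have K2' : 0 <= 4 * (8 * C * r%:R ^+ n.+3 + 3 / c0) :> R.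
  apply: mulr_ge0 => //; apply: addr_ge0; last by rewrite divr_ge0 // ltW.
  by apply: mulr_ge0; [exact: mulr_ge0|exact: exprn_ge0].
have K20 : 0 <= K2 by apply: mulr_ge0.
have i0n i : (i0 <= i)%N -> [/\ (n0 <= r ^ i)%N, 2 * C * r%:R ^+ n.+1 <= (2 ^ i)%:R :> R,
    (2 ^ A.+2 * b ^ 2 < 2 ^ i)%N & (2 <= 2 ^ i)%N].
  move=> hi; have i2 : (i < 2 ^ i)%N by apply: ltn_expl.
  split.
  - apply: (@leq_trans i0); first by rewrite /i0 -addnA leq_addr.
    apply: leq_trans hi (leq_trans (ltnW (ltn_expl i r1)) _); exact: leqnn.
  - apply: ltW; apply: lt_le_trans (truncnS_gt _) _; rewrite ler_nat.
    apply: leq_trans (ltnW i2); apply: leq_trans hi.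
    by rewrite /i0 addnAC leq_addl.
  - apply: leq_trans i2; rewrite ltnS; apply: leq_trans hi; exact: leq_addl.
  rewrite -[X in (X <= _)%N](expn1 2) leq_exp2l //; apply: leq_trans hi.
  by rewrite /i0 addnS addSn.
exists r, (2 * K1 + K2 * (2 * (rho / (rho - 1)))); split => // t.
pose maj i := exists a q, major t (2 ^ i) a q.
pose P i := (i0 <= i)%N && `[< maj i >].
have /choice [f hf] : forall i, exists aq : int * nat, P i -> major t (2 ^ i) aq.1 aq.2.
  move=> i; have [/andP[_ /asboolP[a [q h]]]|nP] := boolP (P i); first by exists (a, q).
  by exists (0, 0%N) => h; case/negP: nP.
pose e i := trunc_log (2 ^ A.+1) (f i).2.
pose be i : R := `|t - (f i).1%:~R / (f i).2%:R|.
have A1 : (1 < 2 ^ A.+1)%N by rewrite -[X in (X < _)%N](expn0 2) ltn_exp2l.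
have same i j : P i -> P j -> e i = e j -> be i = be j.
  move=> Pi Pj; wlog ij : i j Pi Pj / (i <= j)%N.
    move=> hw eij; have [ij|ji] := leqP i j; first exact: hw.
    by apply/esym/hw => //; exact: ltnW.
  move=> eij; have hi := hf i Pi; have hj := hf j Pj.
  have /andP[ii0 _] := Pi; have [_ _ h3 _] := i0n i ii0.
  rewrite /be; congr `|_ - _|; apply: (major_unique h3 _ hi hj).
    by rewrite leq_exp2l.
  (* Equal logarithms make the denominators comparable: [q_j < (2 ^ A.+1) ^ (e + 1) <= 2 ^ A.+1 *
     q_i]. *)
  have [/andP[qi _] _ _] := hi; have [/andP[qj _] _ _] := hj.
  have /andP[bi _] := trunc_log_bounds A1 qi; have /andP[_ bj] := trunc_log_bounds A1 qj.
  apply: leq_trans bj _; rewrite -/(e j) -eij expnS leq_mul2l; apply/orP; right; exact: bi.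
pose v i := if P i then (1 / 2) ^+ e i * hump (be i * rho ^+ i) else 0.
have be0 i : 0 <= be i by exact: normr_ge0.
have v0 i : 0 <= v i.
  rewrite /v; case: ifP => // _; apply: mulr_ge0; first exact: exprn_ge0.
  by rewrite hump_ge0 // mulr_ge0 // exprn_ge0 // ltW // (lt_trans ltr01).
pose w i := K1 * (1 / 2) ^+ i + K2 * v i.
have half0 i : 0 <= (1 / 2) ^+ i :> R by exact: exprn_ge0.
exists w; split.
- by move=> i; apply: addr_ge0; apply: mulr_ge0.
- move=> I; rewrite /w big_split /= -!mulr_sumr; apply: lerD.
    rewrite [leRHS]mulrC ler_wpM2l // big_mkord.
    have := subrX1 (1 / 2 : R) I; have := half0 I; lra.
  rewrite ler_wpM2l // /v -big_mkcond; exact: sparse_hump_sum.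
move=> i L; rewrite expnS => /andP[NL LN].
have NR : 0 < (r ^ i)%:R :> R by rewrite ltr0n expn_gt0 r0.
have T0 : 0 < (2 ^ i)%:R :> R by rewrite ltr0n expn_gt0.
have halfE : (1 / 2) ^+ i = ((2 ^ i)%:R)^-1 :> R by rewrite natrX div1r exprVn.
have triv : `|\sum_(r ^ i <= k < L) sin (2 * pi * t * (F.[k%:Z])%:~R)| <= (r * r ^ i)%:R.
  apply: le_trans (@norm_sum_sin_le R (fun k => 2 * pi * t * (F.[k%:Z])%:~R) _ _) _.
  by rewrite ler_nat (leq_trans (leq_subr _ _)).
have half_le K (x : R) : x <= K / (2 ^ i)%:R -> K <= K1 -> x <= w i.
  move=> hx hK; apply: le_trans hx _; rewrite /w halfE.
  apply: (@le_trans _ _ (K1 / (2 ^ i)%:R)); first by rewrite ler_wpM2r // invr_ge0 ltW.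
  by rewrite lerDl; apply: mulr_ge0.
have [hi|hi] := ltnP i i0.
  apply: le_trans triv _; rewrite natrM mulrC ler_wpM2l ?(ltW NR) //.
  apply: (half_le (r%:R * (2 ^ i0)%:R)); last first.
    by rewrite /K1 lerDr; apply: addr_ge0.
  rewrite ler_pdivlMr // ler_wpM2l // ler_nat leq_exp2l //; exact: ltnW.
have [h1 h2 h3 h4] := i0n i hi.
(* Without a major fraction the sum is at most [r * r ^ i / 2 ^ i], since a larger one would yield
   such a fraction by [large_sum_major]. *)
have [Pi|nPi] := boolP (P i); last first.
  rewrite [leRHS]mulrC -ler_pdivrMr //; apply: (half_le r%:R); last first.
    rewrite /K1 -addrA addrCA lerDl; apply: addr_ge0 => //; exact: mulr_ge0.
  rewrite ler_pdivlMr // mulrAC ler_pdivrMr // -natrM leNgt mulrC.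
  apply/negP => hS; case/negP: nPi; rewrite /P hi /=; apply/asboolP.
  have := @large_sum_major R n A b F weyl sF lF b0 t (r ^ i) r (2 ^ i) L h4 r0.
  rewrite NL LN => /(_ isT hS) [a [q h]]; exists a, q; rewrite /major -rE; exact: h.
have hm := hf i Pi; have /= := @major_block_le n0 C c0 C0 c00 c0C growth growth1 t (2 ^ i) r L (f i).1 (f i).2.
rewrite -rE expn_gt0 => /(_ isT r0); rewrite NL LN => /(_ isT hm h1 h2) hS.
apply: le_trans hS _; rewrite ler_wpM2l ?(ltW NR) // /w halfE; apply: lerD.
  apply: ler_wpM2r; first by rewrite invr_ge0 ltW.
  by rewrite /K1 -addrA lerDl; apply: addr_ge0 => //; exact: mulr_ge0.
rewrite /v Pi.
have -> : (r ^ i)%:R ^+ n.+2 = rho ^+ i :> R by rewrite natrX -!exprM mulnC.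
have hp : 0 <= hump (be i * rho ^+ i).
  by rewrite hump_ge0 // mulr_ge0 // exprn_ge0 // ltW // (lt_trans ltr01).
have [/andP[q0 _] cop _] := hm.
have ratio := complete_sum_ratio q0 cop.
rewrite [leRHS](_ : _ = (b.+1%:R * (1 / 2) ^+ e i) *
   (4 * (8 * C * r%:R ^+ n.+3 + 3 / c0) * hump (be i * rho ^+ i))); last by rewrite /K2; ring.
by apply: ler_wpM2r; first exact: mulr_ge0.
Qed.

End PolynomialBlocks.

Section OddPolynomials.
Context {R : realType}.

Lemma odd_int_polynomial_blocks (F : {poly int}) (n : nat) :
  size F = n.+3 -> (forall j, ~~ odd j -> F`_j = 0) ->
  exists (r : nat) (K : R), (1 < r)%N /\
  forall t : R, exists w : nat -> R, [/\ forall i, 0 <= w i,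
    forall I, \sum_(0 <= i < I) w i <= K &
    forall i L, (r ^ i <= L <= r ^ i.+1)%N ->
      `|\sum_(r ^ i <= k < L) sin (2 * pi * t * (F.[k%:Z])%:~R)| <= (r ^ i)%:R * w i].
Proof.
wlog lF : F / 0 < F`_n.+2.
  move=> hw sF oF; have [pos|] := ltP 0 F`_n.+2; first exact: hw.
  rewrite le_eqVlt => /orP[/eqP l0|neg].
    have : lead_coef F != 0 by rewrite lead_coef_eq0 -size_poly_eq0 sF.
    by rewrite lead_coefE sF /= l0 eqxx.
  have [||j ej|r [K [r1 hK]]] := hw (- F).
  - by rewrite coefN oppr_gt0.
  - by rewrite size_polyN.
  - by rewrite coefN oF // oppr0.
  exists r, K; split => // t; have [w [w0 wK hw']] := hK (- t); exists w; split => // i L hL.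
  have := hw' i L hL; congr (`|_| <= _); apply: eq_bigr => k _.
  by rewrite hornerN mulrNz; congr sin; ring.
move=> sF oF; have [A weyl] := @exists_weyl_inverse R n.+1.
have sF' : (size F <= n.+3)%N by rewrite sF.
have := @polynomial_blocks R n A (absz F`_n.+2) F weyl sF'.
apply => //.
- by rewrite gtz0_abs.
- by rewrite absz_gt0 gt_eqF.
Qed.

(** Clearing denominators replaces [f] by an integer polynomial and rescales [x], which is harmless
    as [x] ranges over all reals. *)
Lemma uniform_cvg_odd_polynomial (c : nat -> R) (alpha : nat) (f : {poly rat}) :
  (forall k, (0 < k)%N -> 0 <= c k) -> (forall k, (0 < k)%N -> c k.+1 <= c k) ->
  (fun k : nat => c k * k%:R) @ \oo --> (0 : R) ->
  odd alpha -> size f = alpha.+1 -> odd_powers_only f ->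
  uniformly_convergent_on setT (sine_sum c (fun k => ratr f.[k%:R])).
Proof.
move=> c0 cd ck oa sf of_; have [F [a a0 fE]] := rat_poly_scale f.
have aQ : (a%:~R : rat)^-1 != 0 by rewrite invr_eq0 intr_eq0.
have sF : size F = alpha.+1.
  by rewrite -sf fE size_scale // size_map_inj_poly //; exact: intr_inj.
have oF j : ~~ odd j -> F`_j = 0.
  move=> /of_; rewrite fE coefZ coef_map /= => /eqP.
  by rewrite mulf_eq0 (negbTE aQ) intr_eq0 => /eqP.
have fR (k : nat) (x : R) : ratr f.[k%:R] * x = (F.[k%:Z])%:~R * (x / a%:~R).
  rewrite fE hornerZ [k%:R](_ : _ = (k%:Z)%:~R :> rat) // (horner_map _ F k%:Z) /=.
  rewrite rmorphM fmorphV /= !ratr_int; ring.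
(* Degree 1 is linear and goes to [linear_blocks]; the remaining odd degrees are at least 3. *)
case: alpha oa sf sF => [//|[|n]] oa sf sF.
- apply: (@uniform_cvg_sine_sum R _ _ _ 2 128) => // x _.
  have [w [w0 wC hw]] := linear_blocks ((F`_1)%:~R * (x / a%:~R)).
  exists w; split => // i L hL; have := hw i L hL.
  congr (`|_| <= _); apply: eq_bigr => k _; rewrite fR; congr sin.
  rewrite (@horner_coef_wide _ 2) ?sF // !big_ord_recl big_ord0 /= (oF 0%N) // mul0r add0r addr0 expr1.
  by rewrite intrM -pmulrn; ring.
have [r [K [r1 hK]]] := odd_int_polynomial_blocks sF oF.
apply: (@uniform_cvg_sine_sum R _ _ _ r K) => // x _.
have [w [w0 wK hw]] := hK (x / a%:~R / (2 * pi)).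
exists w; split => // i L hL; have := hw i L hL.
congr (`|_| <= _); apply: eq_bigr => k _; rewrite fR; congr sin.
have p2 := pi_ge2 R.
rewrite [2 * pi * _]mulrC divfK; first exact: mulrC.
by rewrite gt_eqF // mulr_gt0 //; lra.
Qed.

End OddPolynomials.

Theorem theorem1 (R : realType) (c : nat -> R)
  (c_ge0 : forall k : nat, (0 < k)%N -> 0 <= c k)
  (c_noninc : forall k : nat, (0 < k)%N -> c k.+1 <= c k) :
  (forall alpha : nat, (0 < alpha)%N -> ~~ odd alpha ->
     cvgn (fun L : nat => sine_sum c (fun k => k%:R ^+ alpha) L (pi / 2))
     \/ cvgn (fun L : nat => sine_sum c (fun k => k%:R ^+ alpha) L (2 * pi / 3)) ->
     cvgn (series1 c))
  /\
  (forall (alpha : nat) (f : {poly rat}), odd alpha ->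
     size f = alpha.+1 -> odd_powers_only f ->
     (fun k : nat => c k * k%:R) @ \oo --> (0 : R) ->
     uniformly_convergent_on setT (sine_sum c (fun k => ratr f.[k%:R])))
  /\
  (forall alpha : R, 0 < alpha -> alpha < 2 ->
     (fun k : nat => c k * k%:R) @ \oo --> (0 : R) ->
     forall A : set R, bounded_set A ->
       uniformly_convergent_on A (sine_sum c (fun k => k%:R `^ alpha))).
Proof.
split; last split.
- by move=> alpha; exact: cvg_even_power_sine.
- by move=> alpha f oa sf of_ ck; exact: (uniform_cvg_odd_polynomial c_ge0 c_noninc ck oa sf of_).
(* At [alpha = 1] second differences vanish, so the linear estimate replaces van der Corput's. *)
move=> alpha a0 a2 ck A bA; have [a1|a1] := eqVneq alpha 1; last first.
  exact: uniform_cvg_power_sine.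
apply: (@uniform_cvg_sine_sum R _ _ _ 2 128) => // x _.
have [w [w0 wC hw]] := linear_blocks x.
exists w; split => // i L hL; have := hw i L hL.
by congr (`|_| <= _); apply: eq_bigr => k _; rewrite a1 powRr1.
Qed.
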